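(* Assume (A1), (A2) and (A4) below, and let $\varepsilon_\diamond$ be as below. Fix $0<\alpha<1/2$, let $\varepsilon_n=\varepsilon_\diamond n^{-\alpha}$ for $n\in\mathbb{N}_+$, and define the events $$\mathcal{E}_n=\big\{\omega:\|\mathbf{F}_{\omega,n}(\mathbf{a})-\mathbb{F}(\mathbf{a})\|_2<\varepsilon_n\ \forall\mathbf{a}\in\operatorname{cl}\mathbb{B}_R^N\big\}\cap\big\{\omega:\mathbb{A}_{-\varepsilon_n}\subseteq A_{\omega,n}\subseteq\mathbb{A}_{\varepsilon_n}\big\}.$$ Then $\mathbb{P}\{\limsup_{n\to\infty}\mathcal{E}_n^c\}=\mathbb{P}\{\mathcal{E}_n^c\text{ infinitely often}\}=0$. Consequently there exists $\tilde\Omega\subseteq\Omega$ with $\mathbb{P}(\tilde\Omega)=1$ such that for every $\omega\in\tilde\Omega$ there is $n_\omega\in\mathbb{N}_+$ with $\omega\in\mathcal{E}_n$ for all $n>n_\omega$.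
   Context: Setting. $(\Omega,\mathcal{F},\mathbb{P})$ is a probability space; $N,d\in\mathbb{N}_+$, $R>0$, $\lambda>0$. $\mathcal{X}\subseteq\mathbb{R}^{n_x}$, $\mathcal{Y}\subseteq\mathbb{R}^{n_y}$ are compact; $X:\Omega\to\mathcal{X}$, $Y:\Omega\to\mathcal{Y}$ are random variables. $\phi_1,\dots,\phi_d$ are continuous on $\mathcal{X}$, $\Phi^d(x)=[\phi_l(x)]_{l=1}^d$. $\mathbb{B}_R=\{a\in\mathbb{R}^d:\|a\|_2<R\}$, $\operatorname{cl}\mathbb{B}_R$ its closure, $\operatorname{cl}\mathbb{B}_R^N=\prod_{i=1}^N\operatorname{cl}\mathbb{B}_R\subseteq\mathbb{R}^{Nd}$. A profile $\mathbf{a}=[a^1;\dots;a^N]$, $a^i\in\mathbb{R}^d$, defines $\hat z^i(x)=\sum_l a^i_l\phi_l(x)$ and $\hat z^{-i}(x)$ (stack over $j\neq i$). $\hat{\mathcal{Z}}^i=\bigcup\{\hat z^i(\mathcal{X}):a^i\in\operatorname{cl}\mathbb{B}_R\}$, $\hat{\mathcal{Z}}=\prod_i\hat{\mathcal{Z}}^i$. Player $i$ has objective $J^i(z^i;y,z^{-i})$ (derivative $\partial J^i$ in $z^i$) and constraint $h^i:\hat{\mathcal{Z}}^i\times\mathcal{Y}\to\mathbb{R}$. $F(z;y)=[\partial J^i(z^i;y,z^{-i})]_i$; $\mathbf{F}(\mathbf{a};x,y)=[\partial J^i(\hat z^i(x);y,\hat z^{-i}(x))\Phi^d(x)]_i\in\mathbb{R}^{Nd}$;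 $\mathbb{F}^0(\mathbf{a})=\mathbb{E}[\mathbf{F}(\mathbf{a};X,Y)]$, $\mathbb{F}(\mathbf{a})=\mathbb{F}^0(\mathbf{a})+\lambda\mathbf{a}$; $\mathbf{h}^i(a^i;x,y)=h^i(\hat z^i(x);y)$; $\bar h^i(a^i)=\mathbb{E}[\mathbf{h}^i(a^i;X,Y)]$. $(X^k,Y^k)_{k\ge1}$ are i.i.d. copies of $(X,Y)$ on $\Omega$; $\mathbf{F}_{\omega,n}(\mathbf{a})=\frac1n\sum_{k=1}^n\mathbf{F}(\mathbf{a};X^k(\omega),Y^k(\omega))+\lambda\mathbf{a}$, $\mathbf{h}^i_{\omega,n}(a^i)=\frac1n\sum_{k=1}^n\mathbf{h}^i(a^i;X^k(\omega),Y^k(\omega))$. For $\varepsilon\in\mathbb{R}$: $\mathbb{A}^i_\varepsilon=\{a^i\in\operatorname{cl}\mathbb{B}_R:\bar h^i(a^i)\le\varepsilon\}$, $\mathbb{A}_\varepsilon=\prod_i\mathbb{A}^i_\varepsilon$; $A^i_{\omega,n}=\{a^i\in\operatorname{cl}\mathbb{B}_R:\mathbf{h}^i_{\omega,n}(a^i)\le0\}$, $A_{\omega,n}=\prod_iA^i_{\omega,n}$. (A1) Each $J^i(\cdot;y,z^{-i})$ is continuously differentiable. (A2) For all $y$, $F(\cdot;y)$ is $L_F$-Lipschitz on $\hat{\mathcal{Z}}$ and each $h^i(\cdot;y)$ is $L_h$-Lipschitz on $\hat{\mathcal{Z}}^i$; some $z\in\hat{\mathcal{Z}}$ has $F(z;\mathcal{Y})$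 and all $h^i(z^i;\mathcal{Y})$ bounded. (A4) There is $\varepsilon_h>0$ with $\{a^i\in\operatorname{cl}\mathbb{B}_R:\bar h^i(a^i)\le-\varepsilon_h\}\ne\varnothing$ for every $i$. The constant $\varepsilon_\diamond\in(0,\varepsilon_h)$: for every $\mathbf{a}\in\operatorname{cl}\mathbb{B}_R^N$, each centered random variable $W$ of the form $[\mathbf{F}(\mathbf{a};X,Y)]_l-[\mathbb{F}^0(\mathbf{a})]_l$ or $\mathbf{h}^i(a^i;X,Y)-\bar h^i(a^i)$, with variance $\sigma^2$, has rate function $I(u)=\sup_t\{tu-\log\mathbb{E}[e^{tW}]\}$ satisfying $I(u)\ge u^2/(3\sigma^2)$ for $0<u\le\varepsilon_\diamond$. *)

(* Defs.v *)
From HB Require Import structures.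
From mathcomp Require Import all_boot all_order all_algebra.
From mathcomp Require Import all_classical all_reals all_analysis.
Set Implicit Arguments. Unset Strict Implicit. Unset Printing Implicit Defensive.
Import Order.TTheory GRing.Theory Num.Theory.
Import numFieldNormedType.Exports.
Local Open Scope classical_set_scope.
Local Open Scope ring_scope.

(* Euclidean (Frobenius) 2-norm of a matrix / row vector;
   a profile a in R^{Nd} is represented as an N x d matrix whose row i is a^i. *)
Definition norm2 {R : realType} {m n : nat} (A : 'M[R]_(m, n)) : R :=
  Num.sqrt (\sum_(i < m) \sum_(j < n) A i j ^+ 2).

Definition borel (U : topologicalType) : set (set U) :=
  <<s [set B : set U | open B] >>.

Definition clball {R : realType} {d : nat} (Rr : R) : set 'rV[R]_d :=
  [set b | norm2 b <= Rr].

Definition clballN {R : realType} {N d : nat} (Rr : R) : set 'M[R]_(N, d) :=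
  [set a | forall i, clball Rr (row i a)].

Definition zhat1 {R : realType} {nx d : nat} (phi : 'I_d -> 'rV[R]_nx -> R)
  (b : 'rV[R]_d) (x : 'rV[R]_nx) : R := \sum_(l < d) b 0 l * phi l x.

Definition zhat {R : realType} {nx N d : nat} (phi : 'I_d -> 'rV[R]_nx -> R)
  (a : 'M[R]_(N, d)) (x : 'rV[R]_nx) : 'rV[R]_N :=
  \row_i zhat1 phi (row i a) x.

Definition Zhat1 {R : realType} {nx d : nat} (phi : 'I_d -> 'rV[R]_nx -> R)
  (Xs : set 'rV[R]_nx) (Rr : R) : set R :=
  [set t | exists b : 'rV[R]_d, clball Rr b /\ exists2 x, Xs x & t = zhat1 phi b x].

Definition Zhat {R : realType} {nx N d : nat} (phi : 'I_d -> 'rV[R]_nx -> R)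
  (Xs : set 'rV[R]_nx) (Rr : R) : set 'rV[R]_N :=
  [set z | forall i, Zhat1 phi Xs Rr (z 0 i)].

Definition setc {R : realType} {N : nat} (z : 'rV[R]_N) (i : 'I_N) (t : R) : 'rV[R]_N :=
  \row_j (if j == i then t else z 0 j).

(* J i z y stands for J^i(z^i; y, z^{-i}); dJ is its derivative in z^i *)
Definition dJ {R : realType} {N ny : nat} (J : 'I_N -> 'rV[R]_N -> 'rV[R]_ny -> R)
  (i : 'I_N) (z : 'rV[R]_N) (y : 'rV[R]_ny) : R :=
  derive1 (fun t => J i (setc z i t) y) (z 0 i).

Definition Fgame {R : realType} {N ny : nat} (J : 'I_N -> 'rV[R]_N -> 'rV[R]_ny -> R)
  (z : 'rV[R]_N) (y : 'rV[R]_ny) : 'rV[R]_N := \row_i dJ J i z y.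

Definition Fbf {R : realType} {nx ny N d : nat}
  (J : 'I_N -> 'rV[R]_N -> 'rV[R]_ny -> R) (phi : 'I_d -> 'rV[R]_nx -> R)
  (a : 'M[R]_(N, d)) (x : 'rV[R]_nx) (y : 'rV[R]_ny) : 'M[R]_(N, d) :=
  \matrix_(i, l) (dJ J i (zhat phi a x) y * phi l x).

Definition hbf {R : realType} {nx ny N d : nat} (h : 'I_N -> R -> 'rV[R]_ny -> R)
  (phi : 'I_d -> 'rV[R]_nx -> R) (i : 'I_N) (b : 'rV[R]_d)
  (x : 'rV[R]_nx) (y : 'rV[R]_ny) : R := h i (zhat1 phi b x) y.

Definition Ex {R : realType} {dT : measure_display} {T : measurableType dT}
  (P : probability T R) (f : T -> R) : R :=
  fine (\int[P]_w (f w)%:E).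

Definition F0 {R : realType} {dT : measure_display} {T : measurableType dT}
  (P : probability T R) {nx ny N d : nat}
  (J : 'I_N -> 'rV[R]_N -> 'rV[R]_ny -> R) (phi : 'I_d -> 'rV[R]_nx -> R)
  (X : T -> 'rV[R]_nx) (Y : T -> 'rV[R]_ny) (a : 'M[R]_(N, d)) : 'M[R]_(N, d) :=
  \matrix_(i, l) Ex P (fun w => Fbf J phi a (X w) (Y w) i l).

Definition Fbb {R : realType} {dT : measure_display} {T : measurableType dT}
  (P : probability T R) {nx ny N d : nat}
  (J : 'I_N -> 'rV[R]_N -> 'rV[R]_ny -> R) (phi : 'I_d -> 'rV[R]_nx -> R)
  (X : T -> 'rV[R]_nx) (Y : T -> 'rV[R]_ny) (lam : R) (a : 'M[R]_(N, d)) :=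
  F0 P J phi X Y a + lam *: a.

Definition hbar {R : realType} {dT : measure_display} {T : measurableType dT}
  (P : probability T R) {nx ny N d : nat}
  (h : 'I_N -> R -> 'rV[R]_ny -> R) (phi : 'I_d -> 'rV[R]_nx -> R)
  (X : T -> 'rV[R]_nx) (Y : T -> 'rV[R]_ny) (i : 'I_N) (b : 'rV[R]_d) : R :=
  Ex P (fun w => hbf h phi i b (X w) (Y w)).

(* bold F_{w,n}(a): the k-th i.i.d. copy (X^{k+1}, Y^{k+1}) of the paper is (Xk k, Yk k) *)
Definition Femp {R : realType} {T : Type} {nx ny N d : nat}
  (J : 'I_N -> 'rV[R]_N -> 'rV[R]_ny -> R) (phi : 'I_d -> 'rV[R]_nx -> R)
  (Xk : nat -> T -> 'rV[R]_nx) (Yk : nat -> T -> 'rV[R]_ny) (lam : R)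
  (n : nat) (w : T) (a : 'M[R]_(N, d)) : 'M[R]_(N, d) :=
  n%:R^-1 *: (\sum_(k < n) Fbf J phi a (Xk k w) (Yk k w)) + lam *: a.

Definition hemp {R : realType} {T : Type} {nx ny N d : nat}
  (h : 'I_N -> R -> 'rV[R]_ny -> R) (phi : 'I_d -> 'rV[R]_nx -> R)
  (Xk : nat -> T -> 'rV[R]_nx) (Yk : nat -> T -> 'rV[R]_ny)
  (i : 'I_N) (n : nat) (w : T) (b : 'rV[R]_d) : R :=
  n%:R^-1 * \sum_(k < n) hbf h phi i b (Xk k w) (Yk k w).

Definition Abar {R : realType} {dT : measure_display} {T : measurableType dT}
  (P : probability T R) {nx ny N d : nat}
  (h : 'I_N -> R -> 'rV[R]_ny -> R) (phi : 'I_d -> 'rV[R]_nx -> R)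
  (X : T -> 'rV[R]_nx) (Y : T -> 'rV[R]_ny) (Rr eps : R) : set 'M[R]_(N, d) :=
  [set a | forall i, clball Rr (row i a) /\ hbar P h phi X Y i (row i a) <= eps].

Definition Aemp {R : realType} {T : Type} {nx ny N d : nat}
  (h : 'I_N -> R -> 'rV[R]_ny -> R) (phi : 'I_d -> 'rV[R]_nx -> R)
  (Xk : nat -> T -> 'rV[R]_nx) (Yk : nat -> T -> 'rV[R]_ny) (Rr : R)
  (n : nat) (w : T) : set 'M[R]_(N, d) :=
  [set a | forall i, clball Rr (row i a) /\ hemp h phi Xk Yk i n w (row i a) <= 0].

Definition epsn {R : realType} (epsd alpha : R) (n : nat) : R :=
  epsd * powR (n%:R) (- alpha).

Definition Event {R : realType} {dT : measure_display} {T : measurableType dT}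
  (P : probability T R) {nx ny N d : nat}
  (J : 'I_N -> 'rV[R]_N -> 'rV[R]_ny -> R) (h : 'I_N -> R -> 'rV[R]_ny -> R)
  (phi : 'I_d -> 'rV[R]_nx -> R) (X : T -> 'rV[R]_nx) (Y : T -> 'rV[R]_ny)
  (Xk : nat -> T -> 'rV[R]_nx) (Yk : nat -> T -> 'rV[R]_ny)
  (Rr lam epsd alpha : R) (n : nat) : set T :=
  [set w | (forall a : 'M[R]_(N, d), clballN Rr a ->
              norm2 (Femp J phi Xk Yk lam n w a - Fbb P J phi X Y lam a)
                < epsn epsd alpha n)
         /\ Abar P h phi X Y Rr (- epsn epsd alpha n) `<=` Aemp h phi Xk Yk Rr n w
         /\ Aemp h phi Xk Yk Rr n w `<=` Abar P h phi X Y Rr (epsn epsd alpha n)].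

Definition ratefun {R : realType} {dT : measure_display} {T : measurableType dT}
  (P : probability T R) (W : T -> R) (u : R) : \bar R :=
  ereal_sup [set ((t * u) - ln (Ex P (fun w => expR (t * W w))))%:E | t in [set: R]].

(* I(u) >= u^2 / (3 sigma^2) for 0 < u <= eps, sigma^2 = Var W = E[W^2] (W centered) *)
Definition rate_bound {R : realType} {dT : measure_display} {T : measurableType dT}
  (P : probability T R) (W : T -> R) (eps : R) : Prop :=
  forall u, 0 < u <= eps ->
    ((u ^+ 2 / (3 * Ex P (fun w => W w ^+ 2)))%:E <= ratefun P W u)%E.

Definition indep_seq {R : realType} {dT : measure_display} {T : measurableType dT}
  (P : probability T R) {U : topologicalType} (Z : nat -> T -> U) : Prop :=
  forall (s : seq nat) (E : nat -> set T), uniq s ->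
    (forall k, k \in s -> exists2 B, @borel U B & E k = Z k @^-1` B) ->
    fine (P (\bigcap_(k in [set k | k \in s]) E k)) = \prod_(k <- s) fine (P (E k)).

(* Main.v *)
(** For bounded i.i.d. samples, Chernoff's bound with exponent t of order
    n^(-1/2) shows that an empirical mean misses its expectation by
    c n^(-alpha) with probability O(exp(- c' n^(1/2 - alpha))).  Being bounded
    and Lipschitz in the profile a, uniformly in (x, y), the entries of F and
    the h^i need only be controlled on a net of mesh of order 1/n of the
    (bounded) set of profiles; this costs a factor polynomial in n, and the
    resulting bounds are still summable, so that Borel-Cantelli applies to
    each of the finitely many scalar families.  A uniform estimate of the
    h^i by epsilon_n yields both inclusions between the feasible sets. *)

(* Because t does not depend on the deviation b, Chernoff's exponent is linear in b, of size
   [Num.sqrt n%:R * b] up to a constant, instead of quadratic. For b of order n^(-alpha) it still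
   grows like n^(1/2 - alpha), a positive power of n when alpha < 1/2, and so beats every
   polynomial. Measurability shapes the rest. The exceptional sets quantify over uncountably many
   profiles; they are only shown to be negligible, by enclosing them in measurable limsups of finite
   unions over nets. Moreover [J i z] and [h i t] are assumed Borel in y at a fixed first argument,
   whereas the integrands evaluate them at points that move with x. Joint measurability is recovered
   from difference quotients, for the derivative, and from the Lipschitz dependence on the first
   argument. *)
Require Import Defs.
From HB Require Import structures.
From mathcomp Require Import all_boot all_order all_algebra.
From mathcomp Require Import all_classical all_reals all_analysis.
From mathcomp Require Import finmap measurable_realfun.
From mathcomp Require Import ring lra zify.
Set Implicit Arguments. Unset Strict Implicit. Unset Printing Implicit Defensive.
Import Order.TTheory GRing.Theory Num.Theory.
Import numFieldNormedType.Exports.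
Local Open Scope classical_set_scope.
Local Open Scope ring_scope.

(** * Expectation of a product of independent variables *)

Section independence.
Context {d d' : measure_display} {T : measurableType d} {U : measurableType d'}.
Context {R : realType}.
Implicit Types (P : {measure set T -> \bar R}) (Z : T -> U).
Import HBNNSimple.

(** The factorization passes from indicators to simple functions by linearity and to [g] by monotone
    convergence. In the application [H] is the product over the other indices and [c] the product of
    their expectations. *)
Lemma ge0_integral_comp_mul P Z (H : T -> R) (c : R) (g : U -> R) :
  measurable_fun setT Z -> measurable_fun setT H -> (forall w, 0 <= H w) ->
  0 <= c ->
  (forall B, measurable B ->
    \int[P]_w ((\1_B (Z w) * H w)%:E) = c%:E * \int[P]_w (\1_B (Z w))%:E)%E ->
  measurable_fun setT g -> (forall u, 0 <= g u) ->
  (\int[P]_w (g (Z w) * H w)%:E = c%:E * \int[P]_w (g (Z w))%:E)%E.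
Proof.
move=> mZ mH H0 c0 ind mg g0.
have /measurable_EFinP mEg := mg.
pose f_ := nnsfun_approx measurableT mEg.
have f_cvg w : f_ n (Z w) @[n --> \oo] --> g (Z w).
  have /= : EFin \o f_^~ (Z w) @ \oo --> (EFin \o g) (Z w).
    by apply: cvg_nnsfun_approx => // *; rewrite lee_fin.
  by move=> /fine_cvgP[].
have nd w m n : (m <= n)%N -> f_ m (Z w) <= f_ n (Z w).
  by move=> mn; exact/lefP/nd_nnsfun_approx.
have mfZ n : measurable_fun setT (fun w => f_ n (Z w)).
  by apply: measurableT_comp.
have simple n : (\int[P]_w (f_ n (Z w) * H w)%:E = c%:E * \int[P]_w (f_ n (Z w))%:E)%E.
  have fE u := fimfunEord (f_ n) u; simpl in fE.
  set s := fset_set _ in fE.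
  have s0 (i : 'I_#|` s|) : 0 <= s`_i.
    have : s`_i \in s by rewrite mem_nth.
    by rewrite in_fset_set// => /set_mem [u _ <-]; exact: fun_ge0.
  pose B i := f_ n @^-1` [set s`_i].
  have mB i : measurable (B i) by exact: measurable_sfunP.
  have mBZ i : measurable_fun setT (fun w => \1_(B i) (Z w) : R).
    by apply: measurableT_comp => //; exact: measurable_indic.
  transitivity (\sum_(i < #|` s|) (s`_i)%:E * \int[P]_w (\1_(B i) (Z w) * H w)%:E)%E.
    under eq_integral => w _.
      rewrite fE mulr_suml -sumEFin; under eq_bigr do rewrite -mulrA.
    over.
    rewrite /= ge0_integral_sum//; last 2 first.
    - move=> i; apply/measurable_EFinP/measurable_funM => //. exact: (measurable_funM (mBZ i)).
    - by move=> i w _; rewrite lee_fin !mulr_ge0.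
    apply: eq_bigr => i _; under eq_integral do rewrite EFinM.
    rewrite ge0_integralZl_EFin//.
      by move=> w _; rewrite lee_fin mulr_ge0.
    by apply/measurable_EFinP; exact: (measurable_funM (mBZ i)).
  transitivity (c%:E * (\sum_(i < #|` s|) (s`_i)%:E * \int[P]_w (\1_(B i) (Z w))%:E))%E.
    rewrite ge0_sume_distrr; last first.
      move=> i _; rewrite mule_ge0 ?lee_fin//; apply: integral_ge0 => w _.
      by rewrite lee_fin.
    by apply: eq_bigr => i _; rewrite ind// muleCA.
  congr (c%:E * _)%E; apply/esym.
  under eq_integral => w _.
    rewrite fE -sumEFin; over.
  rewrite /= ge0_integral_sum//; last 2 first.
  - by move=> i; apply/measurable_EFinP/measurable_funM => //; exact: (mBZ i).
  - by move=> i w _; rewrite lee_fin mulr_ge0.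
  apply: eq_bigr => i _; under eq_integral do rewrite EFinM.
  rewrite ge0_integralZl_EFin//.
  by apply/measurable_EFinP; exact: (mBZ i).
have gHE : (\int[P]_w (g (Z w) * H w)%:E =
    limn (fun n => \int[P]_w (f_ n (Z w) * H w)%:E))%E.
  rewrite -monotone_convergence//.
  - apply: eq_integral => w _; apply/esym/cvg_lim => //.
    by apply: cvg_EFin; [exact: nearW|apply: cvgMl; exact: f_cvg].
  - by move=> n; apply/measurable_EFinP/measurable_funM.
  - by move=> n w _; rewrite lee_fin mulr_ge0.
  - by move=> w _ m n mn; rewrite lee_fin ler_wpM2r// nd.
have gE : (\int[P]_w (f_ n (Z w))%:E @[n --> \oo] --> \int[P]_w (g (Z w))%:E)%E.
  have -> : (\int[P]_w (g (Z w))%:E = \int[P]_w limn (fun n => (f_ n (Z w))%:E))%E.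
    apply: eq_integral => w _; apply/esym/cvg_lim => //.
    by apply: cvg_EFin; [exact: nearW|exact: f_cvg].
  apply: cvg_monotone_convergence => //.
  - by move=> n; apply/measurable_EFinP.
  - by move=> n w _; rewrite lee_fin.
  - by move=> w _ m n mn; rewrite lee_fin nd.
rewrite gHE; under eq_fun do rewrite simple.
apply/cvg_lim => //.
by apply: cvgeZl => //.
Qed.

(** Independence enters through indicators only. The integrals must be finite because [fine] sends
    [+oo] to 0. *)
Lemma integral_prod_comp P (Z : nat -> T -> U) (g : nat -> U -> R) (n : nat) :
  (forall k, measurable_fun setT (Z k)) ->
  (forall B : nat -> set U, (forall k, measurable (B k)) ->
    (\int[P]_w (\prod_(k < n) \1_(B k) (Z k w))%:E =
     (\prod_(k < n) fine (\int[P]_w (\1_(B k) (Z k w))%:E))%:E)%E) ->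
  (forall k, measurable_fun setT (g k)) -> (forall k u, 0 <= g k u) ->
  (P setT < +oo)%E ->
  (forall k, \int[P]_w (g k (Z k w))%:E < +oo)%E ->
  (\int[P]_w (\prod_(k < n) g k (Z k w))%:E =
   (\prod_(k < n) fine (\int[P]_w (g k (Z k w))%:E))%:E)%E.
Proof.
move=> mZ indep mg g0 Pfin.
have indfin k B : measurable B -> (\int[P]_w (\1_B (Z k w))%:E < +oo)%E.
  move=> mB.
  have mZB : measurable (Z k @^-1` B) by rewrite -[_ @^-1` _]setTI; exact: mZ.
  rewrite [ltLHS](_ : _ = \int[P]_w (\1_(Z k @^-1` B) w)%:E)%E//.
  rewrite integral_indic// setIT; apply: le_lt_trans Pfin.
  by apply: le_measure; [exact/mem_set|exact/mem_set|exact: subsetT].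
(* The functions are replaced by indicators from index [m] on; one more
   arbitrary function is admitted at each step of the induction on [m]. *)
suff main m : forall g : nat -> U -> R,
  (forall k, measurable_fun setT (g k)) -> (forall k u, 0 <= g k u) ->
  (forall k, \int[P]_w (g k (Z k w))%:E < +oo)%E ->
  (forall k, (m <= k)%N -> exists2 B, measurable B & g k = \1_B) ->
  (\int[P]_w (\prod_(k < n) g k (Z k w))%:E =
   (\prod_(k < n) fine (\int[P]_w (g k (Z k w))%:E))%:E)%E.
  move=> gfin.
  (* Indices from [n] on do not occur in the product; giving them the indicator of [setT] meets the
     last hypothesis of [main] with [m := n]. *)
  pose g' k := if (k < n)%N then g k else \1_setT.
  have g'E (k : 'I_n) : g' k = g k by rewrite /g' ltn_ord.
  transitivity (\int[P]_w (\prod_(k < n) g' k (Z k w))%:E)%E.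
    by apply: eq_integral => w _; congr EFin; apply: eq_bigr => k _; rewrite g'E.
  rewrite (main n).
  - by congr EFin; apply: eq_bigr => k _; rewrite g'E.
  - by move=> k; rewrite /g'; case: ifP.
  - by move=> k u; rewrite /g'; case: ifP.
  - move=> k; rewrite /g'; case: ifP => // _.
    exact: indfin.
  - by move=> k nk; rewrite /g' ltnNge nk; exists setT.
elim: m => {mg g0 g} [g mg g0 gfin gi|m IH g mg g0 gfin gi].
  have /choice[B BP] k : exists B, measurable B /\ g k = \1_B.
    by have [B] := gi k isT; exists B.
  have gE k : g k = \1_(B k) by have [] := BP k.
  under eq_integral do under eq_bigr do rewrite gE.
  rewrite indep; last by move=> k; have [] := BP k.
  by congr EFin; apply: eq_bigr => k _; rewrite gE.
pose g' (f : U -> R) k := if k == m then f else g k.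
have mg'1 B : measurable B -> forall k, measurable_fun setT (g' \1_B k).
  by move=> mB k; rewrite /g'; case: ifP.
have g'10 B k u : 0 <= g' \1_B k u by rewrite /g'; case: ifP.
have g'1fin B : measurable B -> forall k, (\int[P]_w (g' \1_B k (Z k w))%:E < +oo)%E.
  move=> mB k; rewrite /g'; case: ifP => // _.
  exact: indfin.
have g'1i B : measurable B ->
    forall k, (m <= k)%N -> exists2 B', measurable B' & g' \1_B k = \1_B'.
  move=> mB k mk; rewrite /g'; case: eqP => [_|/eqP km]; first by exists B.
  by apply: gi; rewrite ltn_neqAle eq_sym km.
(* If [n <= m], index [m] is absent from the product, and [g m] can be exchanged for an indicator at
   no cost. *)
have [nm|mn] := leqP n m.
  have g'E (k : 'I_n) : g' \1_setT k = g k.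
    by rewrite /g' ltn_eqF// (leq_trans (ltn_ord k)).
  have := IH (g' \1_setT) (mg'1 _ measurableT) (g'10 _) (g'1fin _ measurableT) (g'1i _ measurableT).
  under eq_integral do under eq_bigr do rewrite g'E.
  by under [in X in _ = X]eq_bigr do rewrite g'E.
pose i0 := Ordinal mn.
under eq_integral do rewrite (bigD1 i0)//=.
have gne (k : 'I_n) : k != i0 -> forall f, g' f k = g k.
  by move=> ki0 f; rewrite /g' ifN.
(* The induction hypothesis, with an indicator in place of [g m], is exactly the factorization that
   this lemma asks for. *)
rewrite (@ge0_integral_comp_mul P (Z m) (fun w => \prod_(k < n | k != i0) g k (Z k w))
   (\prod_(k < n | k != i0) fine (\int[P]_w (g k (Z k w))%:E))) //.
- rewrite [in RHS](bigD1 i0)//= mulrC EFinM fineK//.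
  by rewrite ge0_fin_numE//; apply: integral_ge0 => w _; rewrite lee_fin.
- under eq_fun do rewrite -big_filter.
  by apply: measurable_prod => k _; exact: measurableT_comp.
- by move=> w; apply: prodr_ge0.
- apply: prodr_ge0 => k _; apply: fine_ge0; apply: integral_ge0 => w _.
  by rewrite lee_fin.
move=> B mB.
have := IH (g' \1_B) (mg'1 _ mB) (g'10 _) (g'1fin _ mB) (g'1i _ mB).
under eq_integral => w _.
  rewrite (bigD1 i0)//= {1}/g' eqxx.
  under eq_bigr => k ki do rewrite gne//.
  over.
move=> ->; rewrite (bigD1 i0)//= {1}/g' eqxx mulrC EFinM fineK; last first.
  have := g'1fin _ mB m; rewrite /g' eqxx => ?.
  by rewrite ge0_fin_numE//; apply: integral_ge0 => w _; rewrite lee_fin.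
by congr (_%:E * _)%E; apply: eq_bigr => k ki; rewrite gne.
Qed.

End independence.

(** * Chernoff's bound for bounded i.i.d. samples *)

Section chernoff.
Context {d d' : measure_display} {T : measurableType d} {U : measurableType d'}.
Context {R : realType} (P : probability T R).

(** Since 1 - x <= exp(-x), exp(x) is at most 1/(1 - x), and (1 + x + 2x^2)(1 - x) = 1 + x^2(1 - 2x)
    is at least 1 as long as x <= 1/2. *)
Lemma expR_le_quadratic (x : R) : x <= 1 / 2 -> expR x <= 1 + x + 2 * x ^+ 2.
Proof.
move=> x12; have x1 : 0 < 1 - x by lra.
have : expR x * (1 - x) <= 1.
  rewrite -[leRHS](expRxMexpNx_1 x) ler_wpM2l ?expR_ge0//.
  by rewrite (le_trans _ (expR_ge1Dx _)).
rewrite -ler_pdivlMr// => /le_trans; apply.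
rewrite ler_pdivrMr//.
have -> : (1 + x + 2 * x ^+ 2) * (1 - x) = 1 + x ^+ 2 * (1 - 2 * x) by ring.
by rewrite lerDl mulr_ge0 ?sqr_ge0//; lra.
Qed.

Lemma bounded_measurable_integrable (f : T -> R) (M : R) :
  measurable_fun setT f -> (forall w, `|f w| <= M) ->
  P.-integrable setT (EFin \o f).
Proof.
move=> mf fM; apply: measurable_bounded_integrable => //.
  by rewrite ltey_eq fin_num_measure.
exists M; split; first exact: num_real.
by move=> x Mx w _ /=; exact: le_trans (ltW Mx).
Qed.

Lemma Ex_cst (r : R) : Ex P (fun _ => r) = r.
Proof. by rewrite /Ex integral_cst//= (@probability_setT _ _ _ P) mule1. Qed.

(** Integrating the quadratic bound removes the linear term, as [W] is centered; then 1 + y <=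
    exp(y). *)
Lemma mgf_le (W : T -> R) (M t : R) : measurable_fun setT W ->
  (forall w, `|W w| <= M) -> Ex P W = 0 -> 0 <= t -> t * M <= 1 / 2 ->
  Ex P (fun w => expR (t * W w)) <= expR (2 * t ^+ 2 * M ^+ 2).
Proof.
move=> mW WM EW t0 tM.
have tW w : t * W w <= 1 / 2.
  by apply: le_trans tM; rewrite ler_wpM2l// (le_trans (ler_norm _)).
have W2 w : W w ^+ 2 <= M ^+ 2.
  by rewrite -real_normK ?num_real// lerXn2r ?nnegrE// (le_trans _ (WM w)).
have mtW : measurable_fun setT (fun w => t * W w) by exact: measurable_funM.
have iW := bounded_measurable_integrable mW WM.
have iexp : P.-integrable setT (EFin \o (fun w => expR (t * W w))).
  apply: (@bounded_measurable_integrable _ (expR (1 / 2))).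
    exact: measurableT_comp.
  by move=> w; rewrite ger0_norm ?expR_ge0// ler_expR.
have ic (r : R) : P.-integrable setT (EFin \o (fun _ => r)).
  exact: (@bounded_measurable_integrable _ `|r|).
have itW : P.-integrable setT (EFin \o (fun w => t * W w)).
  apply: (@bounded_measurable_integrable _ (t * M)) => // w.
  by rewrite normrM (ger0_norm t0) ler_wpM2l.
apply: (@le_trans _ _ (Ex P (fun w => 1 + 2 * t ^+ 2 * M ^+ 2 + t * W w))).
  apply: le_Rintegral => //=.
    apply: (@bounded_measurable_integrable _ (`|1 + 2 * t ^+ 2 * M ^+ 2| + t * M)).
      exact: measurable_funD.
    move=> w; rewrite (le_trans (ler_normD _ _))// lerD2l.
    by rewrite normrM (ger0_norm t0) ler_wpM2l.
  move=> w _; apply: le_trans (expR_le_quadratic (tW w)) _.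
  rewrite addrAC lerD2r lerD2l exprMn mulrA.
  by rewrite ler_wpM2l// mulr_ge0// sqr_ge0.
have -> : Ex P (fun w => 1 + 2 * t ^+ 2 * M ^+ 2 + t * W w) = 1 + 2 * t ^+ 2 * M ^+ 2.
  rewrite /Ex -/(Rintegral P setT _) RintegralD// RintegralZl//.
  by rewrite [X in t * X]EW mulr0 addr0 [LHS]Ex_cst.
exact: expR_ge1Dx.
Qed.

Lemma ge0_integral_law_eq (Z Z' : T -> U) (g : U -> \bar R) :
  measurable_fun setT Z -> measurable_fun setT Z' ->
  (forall B, measurable B -> P (Z @^-1` B) = P (Z' @^-1` B)) ->
  measurable_fun setT g -> (forall u, 0 <= g u)%E ->
  (\int[P]_w g (Z w) = \int[P]_w g (Z' w))%E.
Proof.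
move=> mZ mZ' ZZ' mg g0.
rewrite -[LHS](@ge0_integral_pushforward _ _ _ _ _ _ mZ P setT g)//.
rewrite -[RHS](@ge0_integral_pushforward _ _ _ _ _ _ mZ' P setT g)//.
by apply: eq_measure_integral => B mB _; exact: ZZ'.
Qed.

Variables (Z : nat -> T -> U) (Z0 : T -> U).
Hypothesis mZ : forall k, measurable_fun setT (Z k).
Hypothesis mZ0 : measurable_fun setT Z0.
Hypothesis Zlaw : forall k B, measurable B -> P (Z k @^-1` B) = P (Z0 @^-1` B).
Hypothesis Zind : forall n (B : nat -> set U), (forall k, measurable (B k)) ->
    (\int[P]_w (\prod_(k < n) \1_(B k) (Z k w))%:E =
     (\prod_(k < n) fine (\int[P]_w (\1_(B k) (Z k w))%:E))%:E)%E.

(** Markov's inequality for exp(t S): the indicator of the event is at most exp(t S - t a), whose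
    expectation factorizes by independence into [n] equal moment generating functions. *)
Lemma chernoff_iid (f : U -> R) (M t a : R) (n : nat) :
  measurable_fun setT f -> (forall u, `|f u| <= M) ->
  Ex P (fun w => f (Z0 w)) = 0 -> 0 <= t -> t * M <= 1 / 2 ->
  (P [set w | a <= \sum_(k < n) f (Z k w)]%R <=
    (expR (2 * t ^+ 2 * M ^+ 2 *+ n - t * a))%:E)%E.
Proof.
move=> mf fM Ef t0 tM.
pose S w := \sum_(k < n) f (Z k w).
have mS : measurable_fun setT S.
  by apply: measurable_sum => k; exact: measurableT_comp.
have mA : measurable [set w | a <= S w].
  rewrite -[X in measurable X]setTI (_ : [set w | _] = S @^-1` `[a, +oo[).
    by apply: mS => //; exact: measurable_itv.
  by apply/seteqP; split => w /=; rewrite in_itv/= andbT.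
pose g u := expR (t * f u).
have mg : measurable_fun setT g.
  by apply: measurableT_comp => //; exact: measurable_funM.
have gle u : g u <= expR (t * M).
  by rewrite ler_expR ler_wpM2l// (le_trans (ler_norm _)).
have gint k : (\int[P]_w (g (Z k w))%:E = \int[P]_w (g (Z0 w))%:E)%E.
  apply: (@ge0_integral_law_eq _ _ (EFin \o g)) => //=.
  - by move=> B mB; rewrite Zlaw.
  - exact/measurable_EFinP.
  - by move=> u; rewrite lee_fin expR_ge0.
have gfin k : (\int[P]_w (g (Z k w))%:E < +oo)%E.
  have : P.-integrable setT (EFin \o (g \o Z k)).
    apply: (@bounded_measurable_integrable _ (expR (t * M))).
      exact: measurableT_comp.
    by move=> w /=; rewrite ger0_norm ?expR_ge0.
  by move=> /integrableP[_]; under eq_integral do rewrite /= ger0_norm ?expR_ge0//.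
have -> : (P [set w | (a <= S w)%R] = \int[P]_w (\1_[set w | (a <= S w)%R] w)%:E)%E.
  by rewrite integral_indic// setIT.
apply: (@le_trans _ _ (\int[P]_w ((expR (- (t * a)))%:E * (\prod_(k < n) g (Z k w))%:E))%E).
  apply: ge0_le_integral => //.
  - by apply/measurable_EFinP; exact: measurable_indic.
  - under eq_fun do rewrite -EFinM.
    apply/measurable_EFinP; apply: measurable_funM => //.
    by apply: measurable_prod => k _; exact: measurableT_comp.
  - move=> w _; rewrite -EFinM lee_fin.
    have -> : \prod_(k < n) g (Z k w) = expR (t * S w).
      by rewrite /S mulr_sumr expR_sum.
    rewrite -expRD indicE; case: (boolP (_ \in _)) => [|_]; last exact: expR_ge0.
    by move=> /set_mem /= aS; rewrite -expR0 ler_expR addrC subr_ge0 ler_wpM2l.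
rewrite ge0_integralZl_EFin ?expR_ge0//; last 2 first.
- by move=> w _; rewrite lee_fin prodr_ge0// => *; exact: expR_ge0.
- apply/measurable_EFinP; apply: measurable_prod => k _; exact: measurableT_comp.
rewrite (@integral_prod_comp _ _ _ _ _ P Z (fun=> g))//; last 2 first.
- by move=> *; exact: expR_ge0.
- by rewrite ltey_eq fin_num_measure.
rewrite -EFinM lee_fin expRD mulrC ler_wpM2r ?expR_ge0//.
under eq_bigr do rewrite gint.
rewrite prodr_const card_ord -[X in expR X]mulr_natl expRM_natl.
rewrite lerXn2r ?nnegrE ?expR_ge0//.
- by apply: fine_ge0; apply: integral_ge0 => w _; rewrite lee_fin expR_ge0.
- by apply: (@mgf_le (f \o Z0)) => //; [exact: measurableT_comp|move=> w; exact: fM].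
- by move=> B mB; apply: Zind.
Qed.

Lemma measurable_deviation (f : U -> R) (b : R) (n : nat) :
  measurable_fun setT f ->
  measurable [set w | b <= `|n%:R^-1 * \sum_(k < n) f (Z k w) - Ex P (f \o Z0)|].
Proof.
move=> mf; pose D w := `|n%:R^-1 * \sum_(k < n) f (Z k w) - Ex P (f \o Z0)|.
have mD : measurable_fun setT D.
  apply: measurableT_comp => //; apply: measurable_funB => //.
  apply: measurable_funM => //.
  by apply: measurable_sum => k; exact: measurableT_comp.
rewrite -[X in measurable X]setTI (_ : [set w | _] = D @^-1` `[b, +oo[).
  by apply: mD => //; exact: measurable_itv.
by apply/seteqP; split => w /=; rewrite in_itv/= andbT.
Qed.

(** The one-sided bound is applied to [f - m] and [m - f], which are centered and bounded by
    [2 * M]; the union of the two events accounts for the factor 2. *)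
Lemma deviation_iid (f : U -> R) (M b : R) (n : nat) :
  measurable_fun setT f -> (forall u, `|f u| <= M) -> 0 < M -> (0 < n)%N ->
  (P [set w | b <= `|n%:R^-1 * \sum_(k < n) f (Z k w) - Ex P (f \o Z0)|]%R <=
    (2 * expR (1 / 2 - Num.sqrt n%:R * b / (4 * M)))%:E)%E.
Proof.
move=> mf fM M0 n0.
have n0R : 0 < n%:R :> R by rewrite ltr0n.
set m := Ex P (f \o Z0).
have ifZ : P.-integrable setT (EFin \o (f \o Z0)).
  by apply: (@bounded_measurable_integrable _ M) => //; [exact: measurableT_comp|move=> w; exact: fM].
have mM : `|m| <= M.
  apply: le_trans (le_normr_Rintegral measurableT ifZ) _.
  rewrite -[leRHS]Ex_cst; apply: le_Rintegral => //=.
  - have := integrable_abse ifZ; apply: eq_integrable => // w _ //=.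
  - apply: (@bounded_measurable_integrable _ `|M|) => //.
pose s := Num.sqrt (n%:R : R).
have s0 : 0 < s by rewrite sqrtr_gt0.
have s1 : 1 <= s by rewrite -sqrtr1 ler_sqrt// ler1n.
have s2 : s ^+ 2 = n%:R by rewrite sqr_sqrtr// ler0n.
(* With this exponent the quadratic term of Chernoff's bound, summed over the
   [n] samples, is the constant 1/2. *)
pose t := (4 * M * s)^-1.
have t0 : 0 <= t by rewrite invr_ge0 !mulr_ge0// ltW.
have tM : t * (2 * M) <= 1 / 2.
  rewrite /t; apply: (@le_trans _ _ (2^-1 / s)); last first.
    by rewrite ler_pdivrMr//; lra.
  rewrite le_eqVlt; apply/orP; left; apply/eqP; field.
  by rewrite !gt_eqF.
have exponent : 2 * t ^+ 2 * (2 * M) ^+ 2 *+ n - t * (n%:R * b) =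
    1 / 2 - s * b / (4 * M).
  by rewrite -mulr_natr -s2 /t; field; rewrite !gt_eqF.
have one_sided (g : U -> R) : measurable_fun setT g -> (forall u, `|g u| <= 2 * M) ->
    Ex P (fun w => g (Z0 w)) = 0 ->
    (P [set w | n%:R * b <= \sum_(k < n) g (Z k w)]%R <=
      (expR (1 / 2 - s * b / (4 * M)))%:E)%E.
  by move=> mg gM Eg; rewrite -exponent; exact: chernoff_iid.
have mup (g : U -> R) : measurable_fun setT g ->
    measurable [set w | n%:R * b <= \sum_(k < n) g (Z k w)]%R.
  move=> mg; pose S w := \sum_(k < n) g (Z k w).
  have mS : measurable_fun setT S.
    by apply: measurable_sum => k; exact: measurableT_comp.
  rewrite -[X in measurable X]setTI (_ : [set w | _] = S @^-1` `[n%:R * b, +oo[).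
    by apply: mS => //; exact: measurable_itv.
  by apply/seteqP; split => w /=; rewrite in_itv/= andbT.
pose fp u := f u - m; pose fm u := m - f u.
have mfp : measurable_fun setT fp by exact: measurable_funB.
have mfm : measurable_fun setT fm by exact: measurable_funB.
have icst : P.-integrable setT (EFin \o (fun _ : T => m)).
  exact: (@bounded_measurable_integrable _ `|m|).
have Ep : Ex P (fun w => fp (Z0 w)) = 0.
  rewrite /Ex -/(Rintegral P setT _) RintegralB//.
  by rewrite [X in _ - X]Ex_cst subrr.
have Em : Ex P (fun w => fm (Z0 w)) = 0.
  rewrite /Ex -/(Rintegral P setT _) RintegralB//.
  by rewrite [X in X - _]Ex_cst subrr.
have fpM u : `|fp u| <= 2 * M.
  by rewrite (le_trans (ler_normB _ _))// mulr_natl mulr2n lerD.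
have fmM u : `|fm u| <= 2 * M.
  by rewrite (le_trans (ler_normB _ _))// mulr_natl mulr2n lerD.
apply: (@le_trans _ _ (P ([set w | n%:R * b <= \sum_(k < n) fp (Z k w)]%R `|`
                          [set w | n%:R * b <= \sum_(k < n) fm (Z k w)]%R))).
  apply: le_measure.
  - by apply/mem_set; exact: measurable_deviation.
  - by apply/mem_set; apply: measurableU; exact: mup.
  - move=> w /=; rewrite !sumrB sumr_const card_ord.
    set S := \sum_(k < n) _; rewrite ler_normr => /orP[] H; [left|right].
      rewrite (_ : S - m *+ n = n%:R * (n%:R^-1 * S - m)) ?ler_pM2l//.
      by rewrite mulrBr mulVKf ?gt_eqF// mulr_natl.
    rewrite (_ : m *+ n - S = n%:R * - (n%:R^-1 * S - m)) ?ler_pM2l//.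
    by rewrite opprB mulrBr mulVKf ?gt_eqF// mulr_natl.
rewrite (le_trans (measureU2 _ _ _)); [exact: isT|exact: mup|exact: mup|].
set e := expR _; rewrite (_ : 2 * e = e + e); last by ring.
by rewrite EFinD leeD// one_sided.
Qed.

End chernoff.

(** * Nets and Caratheodory functions *)

Section nets.
Context {R : realType}.

(** Lipschitz estimates are stated in this norm: it dominates [norm2] and splits into row sums,
    which is what the estimates on [zhat1] produce. *)
Definition l1 {m n} (a : 'M[R]_(m, n)) : R := \sum_i \sum_j `|a i j|.

Lemma l1_ge0 m n (a : 'M[R]_(m, n)) : 0 <= l1 a.
Proof. by apply: sumr_ge0 => i _; exact: sumr_ge0. Qed.

Lemma l1_le m n (a : 'M[R]_(m, n)) (e : R) :
  (forall i j, `|a i j| <= e) -> l1 a <= (m * n)%:R * e.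
Proof.
move=> ae; apply: (@le_trans _ _ (\sum_(i < m) \sum_(j < n) e)).
  by apply: ler_sum => i _; exact: ler_sum.
by rewrite !sumr_const !card_ord -mulrnA mulnC mulr_natl.
Qed.

(** Indices of the cells obtained by cutting [-B, B] into [2 * K] intervals in each entry; the extra
    value receives the right endpoint B. *)
Definition grid m n K := {ffun 'I_m * 'I_n -> 'I_(2 * K).+1}.

Lemma card_grid m n K : #|{: grid m n K}| = ((2 * K).+1 ^ (m * n))%N.
Proof. by rewrite card_ffun card_prod !card_ord. Qed.

(* The net is taken inside [S]: the functions it serves are only controlled there. *)
Lemma grid_net m n (S : set 'M[R]_(m, n)) (B : R) (K : nat) :
  0 < B -> (0 < K)%N -> (forall a, S a -> forall i j, `|a i j| <= B) ->
  S !=set0 ->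
  exists s : grid m n K -> 'M[R]_(m, n), (forall c, S (s c)) /\
    forall a, S a -> exists c, l1 (a - s c) <= (m * n)%:R * (B / K%:R).
Proof.
move=> B0 K0 SB [a0 Sa0].
have K0R : 0 < K%:R :> R by rewrite ltr0n.
pose pos (a : 'M[R]_(m, n)) i j := (a i j + B) * (K%:R / B).
pose cell (a : 'M[R]_(m, n)) : grid m n K :=
  [ffun p => inord (Num.truncn (pos a p.1 p.2))].
(* A cell that [S] misses gets the default [a0], so that [s] stays in [S]. *)
pose s c := xget a0 [set a | S a /\ cell a = c].
exists s; split.
  by move=> c; rewrite /s; case: xgetP => [a _ []|].
move=> a Sa; exists (cell a); apply: l1_le => i j.
have [Ss cs] : S (s (cell a)) /\ cell (s (cell a)) = cell a.
  by rewrite /s; case: xgetP => [b _ //|/(_ a)[]].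
have pos_ge0 b : S b -> 0 <= pos b i j.
  move=> /SB/(_ i j); rewrite ler_norml => /andP[? _].
  by apply: mulr_ge0; [lra|rewrite divr_ge0// ltW].
have trunc_le b : S b -> (Num.truncn (pos b i j) < (2 * K).+1)%N.
  move=> Sb; rewrite ltnS -(ler_nat R).
  have /andP[+ _] := truncn_itv (pos_ge0 _ Sb); move/le_trans; apply.
  rewrite /pos natrM mulrA ler_pdivrMr// mulrAC ler_pM2r//.
  by have := SB _ Sb i j; rewrite ler_norml => /andP[_ ?]; lra.
have /(congr1 (fun f : grid m n K => val (f (i, j)))) := cs.
rewrite !ffunE /= !inordK ?trunc_le// => tE.
have /andP[a1 a2] := truncn_itv (pos_ge0 _ Sa).
have /andP[s1 s2] := truncn_itv (pos_ge0 _ Ss).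
rewrite tE in s1 s2.
set q := Num.truncn _ in a1 a2 s1 s2.
(* Equal integer parts put the two rescaled entries at distance at most 1, that is, [B / K%:R]
   before rescaling. *)
have : `|pos a i j - pos (s (cell a)) i j| <= 1.
  rewrite -natr1 in a2 s2.
  by rewrite ler_norml; apply/andP; split; lra.
rewrite /pos -mulrBl opprD addrACA subrr addr0 normrM.
have KB : 0 < K%:R / B by rewrite divr_gt0.
by rewrite (gtr0_norm KB) -ler_pdivlMr// div1r invf_div !mxE.
Qed.

(** Measurability in [u] at each fixed matrix and a Lipschitz bound in the matrix give measurability
    along a moving argument [z u]. Boundedness of [S] provides finite nets of every mesh, hence a
    countable union for each ray. *)
Lemma measurable_fun_caratheodory d (U : measurableType d) (D : set U)
    m n (S : set 'M[R]_(m, n)) (B L : R)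
    (z : U -> 'M[R]_(m, n)) (g : 'M[R]_(m, n) -> U -> R) :
  0 < B -> (forall a, S a -> forall i j, `|a i j| <= B) -> 0 <= L ->
  (forall i j, measurable_fun D (fun u => z u i j)) ->
  (forall u, D u -> S (z u)) ->
  (forall s, S s -> measurable_fun D (g s)) ->
  (forall u, D u -> forall s s', S s -> S s' -> `|g s u - g s' u| <= L * l1 (s - s')) ->
  measurable_fun D (fun u => g (z u) u).
Proof.
move=> B0 SB L0 mz Sz mg gL mD.
have [D0|/set0P[u0 Du0]] := eqVneq D set0.
  by move=> Y mY; rewrite D0 set0I; exact: measurable0.
have S0 : S !=set0 by exists (z u0); exact: Sz.
have net K : exists s : grid m n K.+1 -> 'M[R]_(m, n),
    (forall c, S (s c)) /\
    forall a, S a -> exists c, l1 (a - s c) <= (m * n)%:R * (B / K.+1%:R).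
  exact: grid_net.
pose s K := sval (cid (net K)); have sP K := svalP (cid (net K)).
suff rays : preimage_set_system D (fun u => g (z u) u) (RGenOInfty.G (R := R))
    `<=` measurable.
  exact: (measurability _ (RGenOInfty.measurableE R) rays mD).
move=> _ [_ [r ->] <-].
(* [g (z u) u] is the supremum of the [l K c u], since [g] is Lipschitz in [z]. *)
pose l K c u := g (s K c) u - L * l1 (z u - s K c).
have ml K c : measurable_fun D (l K c).
  apply: measurable_funB; first by apply: mg; have [sS _] := sP K; exact: sS.
  apply: measurable_funM => //; rewrite /l1.
  apply: measurable_sum => i; apply: measurable_sum => j.
  apply: measurableT_comp => //.
  under eq_fun do rewrite !mxE.
  exact: measurable_funB.
rewrite (_ : _ `&` _ = \bigcup_K \bigcup_(c in [set: grid m n K.+1])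
    (D `&` l K c @^-1` `]r, +oo[)).
  apply: bigcupT_measurable => K; apply: fin_bigcup_measurable => [|c _]; first exact: finite_finset.
  by apply: ml => //; exact: measurable_itv.
apply/seteqP; split => u /=.
- move=> [Du]; rewrite in_itv/= andbT => ru.
  pose e := g (z u) u - r; have e0 : 0 < e by rewrite subr_gt0.
  (* The factor 2: [l K c u] lies below [g (z u) u] by at most one Lipschitz error for moving to the
     net point plus the equal amount subtracted in [l]. *)
  pose C := 2 * L * ((m * n)%:R * B).
  have C0 : 0 <= C by rewrite !mulr_ge0// ltW.
  pose K := Num.truncn (C / e).
  have Ke : C / K.+1%:R < e.
    by rewrite ltr_pdivrMr// mulrC -ltr_pdivrMr// truncnS_gt.
  have [sS /(_ _ (Sz _ Du))[c cP]] := sP K.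
  exists K => //; exists c => //; split => //.
  rewrite /= in_itv/= andbT /l.
  have := gL _ Du _ _ (Sz _ Du) (sS c); rewrite ler_norml => /andP[_ H].
  have := ler_wpM2l L0 cP => H2.
  have : C / K.+1%:R = 2 * (L * ((m * n)%:R * (B / K.+1%:R))).
    by rewrite /C; field.
  rewrite /e in Ke; move=> CE; rewrite CE in Ke.
  move: Ke H2 H; set X := L * l1 _; set Y := L * (_ * _).
  set gs := g (s _ _) u; set gz := g (z u) u => Ke H2 H; lra.
- move=> [K _ [c _ [Du]]]; rewrite /= in_itv/= andbT /l => rl.
  split=> //; rewrite in_itv/= andbT.
  have [sS _] := sP K.
  have := gL _ Du _ _ (Sz _ Du) (sS c); rewrite ler_norml => /andP[H _].
  lra.
Qed.

End nets.

(** * Uniform rate of convergence of empirical means *)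

Section uniform_rate.
Context {R : realType}.

Lemma telescope_le1 (n : nat) :
  \sum_(0 <= k < n) (k.+1%:R * k.+2%:R)^-1 <= 1 :> R.
Proof.
suff -> : \sum_(0 <= k < n) (k.+1%:R * k.+2%:R)^-1 = 1 - n.+1%:R^-1 :> R.
  by rewrite lerBlDr lerDl invr_ge0.
elim: n => [|n IH]; first by rewrite big_geq// invr1 subrr.
rewrite big_nat_recr//= IH -[n.+2%:R]natr1.
have : n.+1%:R != 0 :> R by [].
have : n.+1%:R + 1 != 0 :> R by rewrite natr1.
move: (n.+1%:R) => x x1 x0; field.
by rewrite x1 x0.
Qed.

(** Comparison of 1/x^2 with 2/(x(x + 1)), valid for x >= 1, whose sum telescopes. *)
Lemma nneseries_le_inv_sqr (u : nat -> \bar R) (C : R) :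
  (forall n, 0 <= u n)%E -> (forall n, u n <= (C / n.+1%:R ^+ 2)%:E)%E ->
  (\sum_(n <oo) u n < +oo)%E.
Proof.
move=> u0 uC.
have C0 : 0 <= C.
  by have := le_trans (u0 0%N) (uC 0%N); rewrite lee_fin expr1n divr1.
apply: (@le_lt_trans _ _ (2 * C)%:E); last exact: ltry.
apply: lime_le; first exact: is_cvg_nneseries.
apply: nearW => n.
apply: (@le_trans _ _ (\sum_(0 <= k < n) (2 * C * (k.+1%:R * k.+2%:R)^-1)%:E)%E).
  apply: lee_sum => k _; apply: le_trans (uC k) _.
  rewrite lee_fin -[k.+2%:R]natr1 -subr_ge0.
  have : 1 <= k.+1%:R :> R by rewrite ler1n.
  move: (k.+1%:R) => x x1.
  rewrite (_ : _ - _ = C * (x - 1) / (x ^+ 2 * (x + 1))); last first.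
    by field; rewrite !gt_eqF//; lra.
  by rewrite divr_ge0 ?mulr_ge0 ?sqr_ge0//; lra.
rewrite sumEFin lee_fin -mulr_sumr ler_piMr ?telescope_le1// mulr_ge0//.
Qed.

(** The exponential dominates the single term of degree [k.+1] of its series, and [k] is chosen so
    that this term outgrows n^(p + 2). *)
Lemma expR_powR_decay (b c : R) (p : nat) : 0 < b -> 0 < c ->
  exists2 C : R, 0 <= C & forall n : nat, (0 < n)%N ->
    n%:R ^+ p * expR (- (c * n%:R `^ b)) <= C / n%:R ^+ 2.
Proof.
move=> b0 c0.
pose k := Num.truncn ((p + 2)%:R / b).
have kb : (p + 2)%:R <= b * k.+1%:R.
  by rewrite mulrC -ler_pdivrMr// ltW// truncnS_gt.
exists (k.+1`!%:R / c ^+ k.+1); first by rewrite divr_ge0// exprn_ge0// ltW.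
move=> n n0.
have n0R : 0 < n%:R :> R by rewrite ltr0n.
set x := c * n%:R `^ b.
have x0 : 0 < x by rewrite mulr_gt0// powR_gt0.
have xk : x ^+ k.+1 / k.+1`!%:R <= expR x.
  by have := expR_ge1Dxn k (ltW x0); apply: le_trans; rewrite lerDr.
have xkn : c ^+ k.+1 * n%:R ^+ (p + 2) <= x ^+ k.+1.
  rewrite /x exprMn ler_wpM2l ?exprn_ge0 ?(ltW c0)//.
  rewrite -[in leRHS]powR_mulrn ?powR_ge0// -powRrM -powR_mulrn ?ler0n//.
  by apply: ler_powR => //; rewrite ler1n.
rewrite expRN ler_pdivrMr ?expR_gt0//.
have cancel : n%:R ^+ p = k.+1`!%:R / c ^+ k.+1 / n%:R ^+ 2 *
    (c ^+ k.+1 * n%:R ^+ (p + 2) / k.+1`!%:R).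
  rewrite exprD; field.
  by rewrite !gt_eqF ?exprn_gt0 ?ltr0n ?fact_gt0.
rewrite [leLHS]cancel ler_wpM2l ?divr_ge0 ?exprn_ge0 ?(ltW c0)//.
apply: le_trans xk; rewrite ler_wpM2r//.
Qed.


Lemma measure_fin_bigcup_le {d} {T : measurableType d}
    (mu : {measure set T -> \bar R}) (I : finType) (A : I -> set T) (e : R) :
  (forall i, measurable (A i)) -> (forall i, mu (A i) <= e%:E)%E ->
  (mu (\bigcup_(i in [set: I]) A i) <= (#|I|%:R * e)%:E)%E.
Proof.
move=> mA Ae.
have -> : \bigcup_(i in [set: I]) A i = \big[setU/set0]_(i <- enum I) A i.
  rewrite -bigcup_seq; apply/seteqP; split => w [i _ Aiw]; exists i => //=.
  by rewrite mem_enum.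
rewrite cardE; elim: (enum I) => [|i s IH].
  by rewrite big_nil measure0 mul0r.
rewrite big_cons /= (le_trans (measureU2 _ _ _))//.
  by apply: bigsetU_measurable.
by rewrite -natr1 addrC mulrDl mul1r EFinD leeD//; exact: Ae.
Qed.

Context {d d' : measure_display} {T : measurableType d} {U : measurableType d'}.
Variables (P : probability T R) (Z : nat -> T -> U) (Z0 : T -> U).
Hypothesis mZ : forall k, measurable_fun setT (Z k).
Hypothesis mZ0 : measurable_fun setT Z0.
Hypothesis Zlaw : forall k B, measurable B -> P (Z k @^-1` B) = P (Z0 @^-1` B).
Hypothesis Zind : forall n (B : nat -> set U), (forall k, measurable (B k)) ->
    (\int[P]_w (\prod_(k < n) \1_(B k) (Z k w))%:E =
     (\prod_(k < n) fine (\int[P]_w (\1_(B k) (Z k w))%:E))%:E)%E.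

(** A deviation at some [a] forces half of it at a nearby net point: passing to the net point
    changes the empirical mean and the expectation by at most a quarter of the tolerance each. A
    mesh of order 1/n is fine enough because alpha < 1. *)
Lemma uniform_rate p q (S : set 'M[R]_(p, q)) (psi : 'M[R]_(p, q) -> U -> R)
    (B M L c alpha : R) :
  0 < B -> (forall a, S a -> forall i j, `|a i j| <= B) ->
  (forall a, S a -> measurable_fun setT (psi a)) ->
  0 < M -> (forall a, S a -> forall u, `|psi a u| <= M) ->
  0 <= L ->
  (forall a a', S a -> S a' -> forall u, `|psi a u - psi a' u| <= L * l1 (a - a')) ->
  0 < c -> 0 < alpha < 1 / 2 ->
  P.-negligible [set w | forall n0 : nat, exists n, (n0 <= n)%N /\ (0 < n)%N /\
    exists2 a, S a & c * n%:R `^ (- alpha) <=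
      `|n%:R^-1 * \sum_(k < n) psi a (Z k w) - Ex P (psi a \o Z0)|].
Proof.
move=> B0 SB mpsi M0 psiM L0 psiL c0 /andP[alpha0 alpha2].
have [S0|/set0P S0] := eqVneq S set0.
  apply: negligibleS (negligible_set0 _) => w /(_ 0%N)[n [_ [_ [a]]]].
  by rewrite S0.
pose dev n a w := `|n%:R^-1 * \sum_(k < n) psi a (Z k w) - Ex P (psi a \o Z0)|.
pose C := 4 * L * ((p * q)%:R * B).
have C0 : 0 <= C by rewrite !mulr_ge0// ltW.
(* Makes the mesh at stage [n] so fine that the Lipschitz error is at most
   a quarter of [c n^(-alpha)]. *)
pose kap := (Num.truncn (C / c)).+1.
have kapC : C / kap%:R <= c.
  by rewrite ler_pdivrMr// mulrC -ler_pdivrMr// ltW// truncnS_gt.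
have net n : exists s : grid p q (kap * n.+1) -> 'M[R]_(p, q), (forall i, S (s i)) /\
    forall a, S a -> exists i, l1 (a - s i) <= (p * q)%:R * (B / (kap * n.+1)%:R).
  by apply: grid_net.
pose s n := sval (cid (net n)); have sP n := svalP (cid (net n)).
have sS n i : S (s n i) by have [+ _] := sP n; apply.
(* Stage [n] deals with sample size [n.+1], which leaves out the empty sample. *)
pose b n : R := c / 2 * n.+1%:R `^ (- alpha).
pose F n := \bigcup_(i in [set: grid p q (kap * n.+1)])
  [set w | b n <= dev n.+1 (s n i) w].
have mdev n i : measurable [set w | b n <= dev n.+1 (s n i) w].
  by apply: measurable_deviation => //; exact: mpsi.
have mF n : measurable (F n).
  by apply: fin_bigcup_measurable => [|i _]; [exact: finite_finset|exact: mdev].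
(* With these, the exponent of [deviation_iid] at [b n] is 1/2 - c' (n + 1)^beta. *)
pose beta := 1 / 2 - alpha; pose c' := c / (8 * M).
have beta0 : 0 < beta by rewrite subr_gt0.
have c'0 : 0 < c' by rewrite divr_gt0// mulr_gt0.
have [D D0 Dle] := expR_powR_decay (p * q) beta0 c'0.
(* The net has (2 kap (n + 1) + 1)^(pq) points, at most (3 kap (n + 1))^(pq); the other factor is
   the constant part of the deviation bound. *)
pose E : R := (3 * kap)%:R ^+ (p * q) * (2 * expR (1 / 2)).
have PF n : (P (F n) <= (E * D / n.+1%:R ^+ 2)%:E)%E.
  pose e := 2 * expR (1 / 2 - c' * n.+1%:R `^ beta).
  apply: (@le_trans _ _ (((2 * (kap * n.+1)).+1 ^ (p * q))%:R * e)%:E).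
    rewrite -card_grid; apply: measure_fin_bigcup_le => // i.
    rewrite /e (_ : c' * _ = Num.sqrt n.+1%:R * b n / (4 * M)).
      apply: deviation_iid => //; first exact: mpsi.
      by move=> u; exact: psiM.
    rewrite -powR12_sqrt ?ler0n// /b /c' /beta powRD; last first.
      by rewrite pnatr_eq0 implybT.
    by rewrite div1r; field; rewrite gt_eqF.
  rewrite lee_fin /e expRD.
  have card_le : ((2 * (kap * n.+1)).+1 ^ (p * q))%:R <=
      (3 * kap)%:R ^+ (p * q) * n.+1%:R ^+ (p * q) :> R.
    rewrite -exprMn -natrM natrX lerXn2r ?nnegrE ?ler0n// ler_nat.
    by rewrite /kap; nia.
  apply: (@le_trans _ _ (E * (n.+1%:R ^+ (p * q) * expR (- (c' * n.+1%:R `^ beta))))).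
    rewrite (_ : E * _ = (3 * kap)%:R ^+ (p * q) * n.+1%:R ^+ (p * q) *
      (2 * (expR (1 / 2) * expR (- (c' * n.+1%:R `^ beta))))); last by rewrite /E; ring.
    by rewrite ler_wpM2r// !mulr_ge0 ?expR_ge0.
  rewrite -mulrA.
  by rewrite ler_wpM2l ?Dle// !mulr_ge0 ?expR_ge0 ?exprn_ge0.
have Flim : P (lim_sup_set F) = 0%E.
  apply: lim_sup_set_cvg0 => //.
  by apply: (nneseries_le_inv_sqr (C := E * D)).
apply: (@negligibleS _ _ _ _ (lim_sup_set F)); last first.
  apply/negligibleP => //.
  apply: bigcap_measurable => // n _; apply: bigcup_measurable => k _; exact: mF.
move=> w bad n _.
(* Asking for a size of at least [n.+1] yields a size [N.+1] with [n <= N], so that [w] falls in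
   [F N]. *)
have [[|N] [nN [// _ [a Sa Ha]]]] := bad n.+1.
exists N => //.
have [_ /(_ _ Sa)[i Hi]] := sP N.
exists i => //=; rewrite /b.
set tau := N.+1%:R `^ (- alpha) in Ha *.
have N0 : 0 < N.+1%:R :> R by rewrite ltr0n.
pose delta := L * l1 (a - s N i).
have delta_tau : delta <= c * tau / 4.
  apply: (@le_trans _ _ (L * ((p * q)%:R * (B / (kap * N.+1)%:R)))).
    by rewrite ler_wpM2l.
  rewrite (_ : _ * _ = C / kap%:R * N.+1%:R^-1 / 4); last first.
    by rewrite /C natrM; field; rewrite addrC natr1 !pnatr_eq0.
  rewrite ler_wpM2r//; apply: ler_pM => //.
  - by rewrite divr_ge0.
  - rewrite -powR_inv1 ?ler0n// /tau ler_powR ?ler1n// lerN2; lra.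
have avg_le : `|N.+1%:R^-1 * \sum_(k < N.+1) psi a (Z k w) -
    N.+1%:R^-1 * \sum_(k < N.+1) psi (s N i) (Z k w)| <= delta.
  rewrite -mulrBr -sumrB normrM gtr0_norm ?invr_gt0// mulrC ler_pdivrMr//.
  apply: le_trans (ler_norm_sum _ _ _) _.
  apply: (@le_trans _ _ (\sum_(k < N.+1) delta)); first by apply: ler_sum => k _; exact: psiL.
  by rewrite sumr_const card_ord mulr_natr.
have ipsi a' : S a' -> P.-integrable setT (EFin \o (psi a' \o Z0)).
  move=> Sa'; apply: (@bounded_measurable_integrable _ _ _ _ _ M).
    by apply: measurableT_comp => //; exact: mpsi.
  by move=> u; exact: psiM.
have E_le : `|Ex P (psi a \o Z0) - Ex P (psi (s N i) \o Z0)| <= delta.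
  have := RintegralB (mu := P) measurableT (ipsi _ Sa) (ipsi _ (sS N i)).
  rewrite /Rintegral -/(Ex P _) -/(Ex P _) -/(Ex P _) => <-.
  have idiff : P.-integrable setT
      (EFin \o (fun u => (psi a \o Z0) u - (psi (s N i) \o Z0) u)).
    apply: (@bounded_measurable_integrable _ _ _ _ _ delta).
      by apply: measurable_funB; apply: measurableT_comp => //; exact: mpsi.
    by move=> u; exact: psiL.
  apply: le_trans (le_normr_Rintegral measurableT idiff) _.
  rewrite -[leRHS](Ex_cst P); apply: le_Rintegral => //=.
  - apply: (@bounded_measurable_integrable _ _ _ _ _ delta).
      apply: measurableT_comp => //.
      by apply: measurable_funB; apply: measurableT_comp => //; exact: mpsi.
    by move=> u; rewrite normr_id; exact: psiL.
  - by apply: (@bounded_measurable_integrable _ _ _ _ _ `|delta|).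
  - by move=> u _; exact: psiL.
rewrite -/(dev _ _ _) in Ha; move: Ha avg_le E_le; rewrite /dev.
set A1 := _^-1 * _; set A2 := _^-1 * _; set E1 := Ex P _; set E2 := Ex P _.
move=> Ha avg_le E_le.
have -> : c / 2 * tau = c * tau - 2 * (c * tau / 4) by field.
rewrite lerBlDr (le_trans Ha)//.
rewrite (_ : A1 - E1 = (A2 - E2) + ((A1 - A2) - (E1 - E2))); last by ring.
rewrite (le_trans (ler_normD _ _))// lerD2l.
rewrite (le_trans (ler_normB _ _))//; lra.
Qed.

(** Extension by 0 outside [D] preserves measurability and both bounds, and is invisible to the
    samples, which never leave [D]. *)
Lemma uniform_rate_on (D : set U) p q (S : set 'M[R]_(p, q))
    (psi : 'M[R]_(p, q) -> U -> R) (B M L c alpha : R) :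
  measurable D -> (forall k w, D (Z k w)) -> (forall w, D (Z0 w)) ->
  0 < B -> (forall a, S a -> forall i j, `|a i j| <= B) ->
  (forall a, S a -> measurable_fun D (psi a)) ->
  0 < M -> (forall a, S a -> forall u, D u -> `|psi a u| <= M) ->
  0 <= L ->
  (forall a a', S a -> S a' -> forall u, D u ->
    `|psi a u - psi a' u| <= L * l1 (a - a')) ->
  0 < c -> 0 < alpha < 1 / 2 ->
  P.-negligible [set w | forall n0 : nat, exists n, (n0 <= n)%N /\ (0 < n)%N /\
    exists2 a, S a & c * n%:R `^ (- alpha) <=
      `|n%:R^-1 * \sum_(k < n) psi a (Z k w) - Ex P (psi a \o Z0)|].
Proof.
move=> mD DZ DZ0 B0 SB mpsi M0 psiM L0 psiL c0 alpha12.
pose psi' a := psi a \_ D.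
have psi'E a u : D u -> psi' a u = psi a u by move=> Du; rewrite /psi' patchE mem_set.
have psi'0 a u : ~ D u -> psi' a u = 0 by move=> Du; rewrite /psi' patchE memNset.
apply: negligibleS (@uniform_rate _ _ S psi' B M L c alpha B0 SB _ M0 _ L0 _ c0 alpha12).
- move=> w bad n0; have [n [n0n [n1 [a Sa Ha]]]] := bad n0.
  exists n; split => //; split => //; exists a => //.
  rewrite (_ : psi' a \o Z0 = psi a \o Z0); last first.
    by apply/funext => v /=; rewrite psi'E.
  by under eq_bigr do rewrite psi'E//.
- by move=> a Sa; exact: (proj1 (measurable_restrictT _ mD) (mpsi _ Sa)).
- move=> a Sa u; have [Du|nDu] := pselect (D u); first by rewrite psi'E//; exact: psiM.
  by rewrite psi'0// normr0 ltW.
- move=> a a' Sa Sa' u; have [Du|nDu] := pselect (D u).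
    by rewrite !psi'E//; exact: psiL.
  by rewrite !psi'0// subr0 normr0 mulr_ge0// l1_ge0.
Qed.

End uniform_rate.

(** * Euclidean norms and Borel measurability *)

Section norm2.
Context {R : realType}.

Lemma norm2_le_l1 m n (A : 'M[R]_(m, n)) : norm2 A <= l1 A.
Proof.
rewrite -[leRHS]ger0_norm ?l1_ge0// -sqrtr_sqr ler_wsqrtr// expr2 {2}/l1 mulr_sumr.
apply: ler_sum => i _; rewrite mulr_sumr; apply: ler_sum => j _.
rewrite -real_normK ?num_real// expr2 ler_wpM2r// /l1 (bigD1 i)//= (bigD1 j)//=.
rewrite -addrA lerDl addr_ge0//; first exact: sumr_ge0.
by apply: sumr_ge0 => k _; exact: sumr_ge0.
Qed.

Lemma entry_le_norm2 m n (A : 'M[R]_(m, n)) i j : `|A i j| <= norm2 A.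
Proof.
rewrite -sqrtr_sqr ler_wsqrtr// (bigD1 i)//= (bigD1 j)//=.
rewrite -addrA lerDl addr_ge0//; first by apply: sumr_ge0 => k _; exact: sqr_ge0.
by apply: sumr_ge0 => k _; apply: sumr_ge0 => l _; exact: sqr_ge0.
Qed.

End norm2.

Section borel.
Context {R : realType}.

(** Its measurable sets are those of [borel] by conversion; on pairs this is the Borel sigma-algebra
    of the product topology, in which the laws of the samples are given. *)
Definition borelType (V : ptopologicalType) := g_sigma_algebraType (@open V).

Lemma closed_borel_measurable (V : ptopologicalType) (D : set V) :
  closed D -> measurable (D : set (borelType V)).
Proof.
move=> cD; rewrite -[X in measurable X]setCK; apply: measurableC.
by apply: sub_sigma_algebra; exact: closed_openC.
Qed.

Lemma within_continuous_borel_measurable (V : ptopologicalType) (D : set V) (f : V -> R) :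
  closed D -> {within D, continuous f} -> measurable_fun (D : set (borelType V)) f.
Proof.
move=> cD cf.
have mD := closed_borel_measurable cD.
suff opens : preimage_set_system (D : set (borelType V)) f (RGenOpens.G (R := R)) `<=` measurable.
  exact: (measurability _ (RGenOpens.measurableE R) opens).
move=> _ [_ [x [y ->]] <-].
have : @open (subspace D) (f @^-1` `]x, y[).
  apply: open_comp; last exact: interval_open.
  by move=> z _; exact: cf.
move=> /open_subspaceP[W oW WE].
rewrite setIC -WE; apply: measurableI => //.
exact: sub_sigma_algebra.
Qed.

Lemma continuous_borel_measurable (V W : ptopologicalType) (f : W -> V) :
  continuous f -> measurable_fun setT (f : borelType W -> borelType V).
Proof.
move=> cf.
suff opens : preimage_set_system setT (f : borelType W -> borelType V) (@open V)
    `<=` measurable.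
  by refine (@measurability _ _ (borelType W) (borelType V) setT f (@open V) _ opens).
move=> _ [W0 oW <-]; rewrite setTI.
by apply: sub_sigma_algebra; apply: open_comp => // *; exact: cf.
Qed.

Lemma borel_preimage_measurable (V : ptopologicalType) (g : V -> R) :
  (forall B, borel B -> borel (g @^-1` B)) -> measurable_fun setT (g : borelType V -> R).
Proof.
move=> bg.
suff opens : preimage_set_system (setT : set (borelType V)) g (RGenOpens.G (R := R))
    `<=` measurable.
  exact: (measurability _ (RGenOpens.measurableE R) opens).
move=> _ [_ [x [y ->]] <-]; rewrite setTI; apply: bg.
by apply: sub_sigma_algebra; exact: interval_open.
Qed.

End borel.

Lemma negligible_fin_bigcup {d} {T : measurableType d} {R : realType}
  (mu : {measure set T -> \bar R}) (I : finType) (A : I -> set T) :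
  (forall i, mu.-negligible (A i)) -> mu.-negligible (\bigcup_(i in [set: I]) A i).
Proof.
move=> nA.
have nU : mu.-negligible (\bigcup_(k : nat) (oapp A set0 (choice.unpickle k : option I))).
  apply: negligible_bigcup => k; case: (choice.unpickle k) => [i|] /=; first exact: nA.
  exact: negligible_set0.
by apply: negligibleS nU => w [i _ Aiw]; exists (choice.pickle i) => //; rewrite choice.pickleK.
Qed.

(** Turns [indep_seq] into the hypothesis [Zind] of the previous sections: a product of indicators
    is the indicator of the intersection of the preimages. *)
Lemma integral_prod_indic_indep {R : realType} {d} {T : measurableType d}
  (P : probability T R) {V : ptopologicalType} (Z : nat -> T -> borelType V) :
  (forall k, measurable_fun setT (Z k)) -> @indep_seq R d T P V Z ->
  forall n (B : nat -> set (borelType V)), (forall k, measurable (B k)) ->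
    (\int[P]_w (\prod_(k < n) \1_(B k) (Z k w))%:E =
     (\prod_(k < n) fine (\int[P]_w (\1_(B k) (Z k w))%:E))%:E)%E.
Proof.
move=> mZ indep n B mB.
pose E k := Z k @^-1` B k.
have mE k : measurable (E k) by rewrite -[E k]setTI; exact: mZ.
have intE k : (\int[P]_w (\1_(B k) (Z k w))%:E = P (E k))%E.
  by rewrite -[X in P X]setIT -integral_indic.
pose C := \bigcap_(k in [set k | k \in iota 0 n]) E k.
have mC : measurable C.
  by apply: bigcap_measurableType => k _; exact: mE.
have := indep (iota 0 n) E (iota_uniq 0 n).
rewrite -/C => indepC.
transitivity (P C).
  rewrite -[C in RHS]setIT -integral_indic//; apply: eq_integral => w _; congr EFin.
  rewrite [RHS]indicE; case: (boolP (w \in C)) => [/set_mem Cw|/negP Cw].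
    rewrite big1// => k _; rewrite indicE mem_set//.
    by apply: (Cw k); rewrite /= mem_iota add0n ltn_ord.
  apply/eqP; rewrite prodf_seq_eq0; apply/hasP.
  apply: contra_notP Cw => H; apply/mem_set => k /=; rewrite mem_iota add0n => kn.
  apply: contra_notP H => nE; exists (Ordinal kn); first exact: mem_index_enum.
  by rewrite /= indicE memNset.
rewrite -[LHS]fineK ?fin_num_measure// indepC.
  congr EFin; rewrite -[n in iota 0 n]subn0 big_mkord.
  by apply: eq_bigr => k _; rewrite intE.
by move=> k _; exists (B k); [exact: mB|].
Qed.

(** * The empirical game *)

Lemma compact_family_bounded {R : realType} {V : topologicalType} (I : finType)
    (K : set V) (f : I -> V -> R) :
  compact K -> (forall i, {within K, continuous (f i)}) ->
  exists2 M, 0 < M & forall i x, K x -> `|f i x| <= M.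
Proof.
move=> cK cf.
have bounded i : exists M, forall x, K x -> `|f i x| <= M.
  have [M [_ MP]] := compact_bounded (continuous_compact (cf i) cK).
  by exists (M + 1) => x Kx; apply: MP; [rewrite ltrDl|exists x].
have [M MP] := choice bounded.
exists (1 + \sum_i `|M i|).
  by rewrite (lt_le_trans ltr01)// lerDl sumr_ge0.
move=> i x Kx; rewrite (le_trans (MP i x Kx))// (bigD1 i)//= addrCA.
by rewrite (le_trans (ler_norm _))// lerDl addr_ge0// sumr_ge0.
Qed.

(** A sequence of steps presents the derivative as a countable limit, through which measurability
    passes. *)
Lemma difference_quotient_cvg {R : realType} (G : R -> R) (t : R) :
  derivable G t 1 ->
  (fun n => n.+1%:R * (G (n.+1%:R^-1 + t) - G t)) @ \oo --> derive1 G t.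
Proof.
move=> dG.
have harmonic0 : (fun n => n.+1%:R^-1 : R) @ \oo --> (0 : R)^'.
  move=> A A0.
  have : \forall n \near \oo, n.+1%:R^-1 != 0 :> R -> A (n.+1%:R^-1).
    exact: (@cvg_harmonic R _ A0).
  by apply: filterS => n; apply; rewrite invr_eq0.
rewrite derive1E.
have := cvg_comp _ _ harmonic0 dG; apply: cvg_trans.
by apply: near_eq_cvg; apply: nearW => n /=; rewrite invrK [_^-1 *: _]mulr1.
Qed.

(* A product of pointed topological types is not declared pointed topological. *)
HB.saturate prod.

Section game.
Context {R : realType} {nx ny N d : nat}.
Variables (Rr : R) (Xs : set 'rV[R]_nx) (Ys : set 'rV[R]_ny).
Variables (phi : 'I_d -> 'rV[R]_nx -> R).
Variables (J : 'I_N -> 'rV[R]_N -> 'rV[R]_ny -> R) (h : 'I_N -> R -> 'rV[R]_ny -> R).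
Hypotheses (Rr0 : 0 < Rr) (cXs : compact Xs) (cYs : compact Ys).
Hypothesis cphi : forall l, {within Xs, continuous (phi l)}.
Variable Phi : R.
Hypotheses (Phi0 : 0 < Phi) (phiM : forall l x, Xs x -> `|phi l x| <= Phi).
Hypothesis HJm : forall i z B, borel B -> borel (J i z @^-1` B).
Hypothesis Hhm : forall i t B, borel B -> borel (h i t @^-1` B).
Hypothesis A1 : forall i (z : 'rV[R]_N) y, Zhat phi Xs Rr z -> Ys y ->
  forall t, derivable (fun t => J i (setc z i t) y) t 1.
Variables LF Lh : R.
Hypothesis A2F : forall y, Ys y -> forall z z' : 'rV[R]_N,
  Zhat phi Xs Rr z -> Zhat phi Xs Rr z' ->
  norm2 (Fgame J z y - Fgame J z' y) <= LF * norm2 (z - z').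
Hypothesis A2h : forall i y, Ys y -> forall t t',
  Zhat1 phi Xs Rr t -> Zhat1 phi Xs Rr t' ->
  `|h i t y - h i t' y| <= Lh * `|t - t'|.

Let U := borelType ('rV[R]_nx * 'rV[R]_ny)%type.
Let D : set U := Xs `*` Ys.

Lemma domain_closed : closed (Xs `*` Ys).
Proof.
apply: compact_closed; last exact: compact_setX.
exact: norm_hausdorff.
Qed.

Lemma domain_measurable : measurable D.
Proof. exact: closed_borel_measurable domain_closed. Qed.

Lemma phi_measurable l : measurable_fun D (fun u => phi l u.1).
Proof.
have cX : closed Xs by apply: compact_closed cXs; exact: norm_hausdorff.
apply: (@measurable_comp _ _ _ U (borelType 'rV[R]_nx) _ Xs (phi l)).
- exact: closed_borel_measurable.
- by move=> _ [u [Xu _] <-].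
- exact: within_continuous_borel_measurable.
- apply: measurable_funTS; apply: continuous_borel_measurable.
  by move=> u; exact: cvg_fst.
Qed.

Lemma snd_borel_measurable (g : 'rV[R]_ny -> R) :
  (forall B, borel B -> borel (g @^-1` B)) -> measurable_fun D (fun u => g u.2).
Proof.
move=> bg; apply: measurable_funTS.
apply: (@measurableT_comp _ _ _ U (borelType 'rV[R]_ny) _ g).
  exact: borel_preimage_measurable.
by apply: continuous_borel_measurable => u; exact: cvg_snd.
Qed.

(** Each difference quotient involves [J i] at two fixed profiles only, where it is Borel in y. *)
Lemma dJ_measurable i z : Zhat phi Xs Rr z -> measurable_fun D (fun u => dJ J i z u.2).
Proof.
move=> zZ.
pose q n (u : U) := n.+1%:R * (J i (setc z i (n.+1%:R^-1 + z 0 i)) u.2 -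
                               J i (setc z i (z 0 i)) u.2).
apply: (@measurable_fun_cvg _ _ _ D q).
  move=> n; apply: measurable_funM => //.
  by apply: measurable_funB; apply: snd_borel_measurable => ?; exact: HJm.
by move=> u [_ Yu]; apply: difference_quotient_cvg; exact: A1.
Qed.

Lemma clballN_entry (a : 'M[R]_(N, d)) : clballN Rr a -> forall i j, `|a i j| <= Rr.
Proof.
move=> Ba i j; have <- : row i a 0 j = a i j by rewrite mxE.
exact: le_trans (entry_le_norm2 _ _ _) (Ba i).
Qed.

Lemma zhat1_bounded (b : 'rV[R]_d) x : clball Rr b -> Xs x ->
  `|zhat1 phi b x| <= d%:R * (Rr * Phi).
Proof.
move=> Bb Xx; apply: le_trans (ler_norm_sum _ _ _) _.
apply: (@le_trans _ _ (\sum_(l < d) Rr * Phi)).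
  apply: ler_sum => l _; rewrite normrM ler_pM// ?phiM//.
  by apply: le_trans Bb; exact: entry_le_norm2.
by rewrite sumr_const card_ord mulr_natl.
Qed.

Lemma zhat1_lipschitz (a a' : 'M[R]_(N, d)) i x : Xs x ->
  `|zhat1 phi (row i a) x - zhat1 phi (row i a') x| <= Phi * \sum_l `|(a - a') i l|.
Proof.
move=> Xx; rewrite -sumrB mulr_sumr; apply: le_trans (ler_norm_sum _ _ _) _.
apply: ler_sum => l _; rewrite !mxE -mulrBl normrM mulrC.
by rewrite ler_wpM2r// phiM.
Qed.

Lemma zhat1_measurable (b : 'rV[R]_d) : measurable_fun D (fun u => zhat1 phi b u.1).
Proof.
apply: measurable_sum => l; apply: measurable_funM => //; exact: phi_measurable.
Qed.

Lemma zhat1_in_Zhat1 (b : 'rV[R]_d) x : clball Rr b -> Xs x ->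
  Zhat1 phi Xs Rr (zhat1 phi b x).
Proof. by move=> Bb Xx; exists b; split => //; exists x. Qed.

Lemma zhat_in_Zhat (a : 'M[R]_(N, d)) x : clballN Rr a -> Xs x ->
  Zhat phi Xs Rr (zhat phi a x).
Proof. by move=> Ba Xx i; rewrite mxE; exact: zhat1_in_Zhat1. Qed.

Lemma Zhat1_bounded t : Zhat1 phi Xs Rr t -> `|t| <= d%:R * (Rr * Phi).
Proof. by move=> [b [Bb [x Xx ->]]]; exact: zhat1_bounded. Qed.

(** The added 1 makes the bound positive even for [d = 0], as the nets require. *)
Let BZ := d%:R * (Rr * Phi) + 1.

Let BZ0 : 0 < BZ.
Proof. by rewrite ltr_wpDl// !mulr_ge0// ltW. Qed.

(** The absolute value appears because the sign of [LF] is not prescribed. *)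
Lemma dJ_lipschitz i z z' y : Ys y -> Zhat phi Xs Rr z -> Zhat phi Xs Rr z' ->
  `|dJ J i z y - dJ J i z' y| <= `|LF| * l1 (z - z').
Proof.
move=> Yy Zz Zz'.
have := entry_le_norm2 (Fgame J z y - Fgame J z' y) 0 i; rewrite !mxE => /le_trans; apply.
apply: le_trans (A2F Yy Zz Zz') _.
apply: (@le_trans _ _ (`|LF| * norm2 (z - z'))).
  by rewrite ler_wpM2r ?sqrtr_ge0// ler_norm.
by rewrite ler_wpM2l// norm2_le_l1.
Qed.

Lemma Zhat_entry_bounded (z : 'rV[R]_N) : Zhat phi Xs Rr z -> forall i j, `|z i j| <= BZ.
Proof.
move=> Zz i j; rewrite (ord1 i) (le_trans (Zhat1_bounded (Zz j)))//.
by rewrite /BZ lerDl.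
Qed.

Lemma dJ_zhat_measurable i (a : 'M[R]_(N, d)) : clballN Rr a ->
  measurable_fun D (fun u => dJ J i (zhat phi a u.1) u.2).
Proof.
move=> Ba.
apply: (@measurable_fun_caratheodory _ _ U D 1 N (Zhat phi Xs Rr) BZ `|LF|
  (fun u => zhat phi a u.1) (fun z u => dJ J i z u.2)) => //.
- exact: Zhat_entry_bounded.
- move=> k j; under eq_fun do rewrite mxE; exact: zhat1_measurable.
- by move=> u [Xu _]; exact: zhat_in_Zhat.
- exact: dJ_measurable.
- by move=> u [_ Yu] z z' Zz Zz'; exact: dJ_lipschitz.
Qed.

Lemma hbf_measurable i (b : 'rV[R]_d) : clball Rr b ->
  measurable_fun D (fun u => hbf h phi i b u.1 u.2).
Proof.
(* The scalar argument is wrapped in a 1 x 1 matrix to fit the nets. *)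
move=> Bb; pose t (u : U) : 'M[R]_(1, 1) := const_mx (zhat1 phi b u.1).
rewrite (_ : (fun u : U => _) = fun u => h i (t u 0 0) u.2); last first.
  by apply/funext => u; rewrite mxE.
apply: (@measurable_fun_caratheodory _ _ U D 1 1
  [set z : 'rV_1 | Zhat1 phi Xs Rr (z 0 0)] BZ `|Lh|
  t (fun z u => h i (z 0 0) u.2)) => //.
- move=> z /= Zz k j; rewrite !ord1 (le_trans (Zhat1_bounded Zz))//.
  by rewrite /BZ lerDl.
- move=> k j; under eq_fun do rewrite mxE; exact: zhat1_measurable.
- by move=> u [Xu _] /=; rewrite mxE; exact: zhat1_in_Zhat1.
- by move=> z /= Zz; apply: snd_borel_measurable => ?; exact: Hhm.
- move=> u [_ Yu] z z' /= Zz Zz'; apply: le_trans (A2h i Yu Zz Zz') _.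
  by rewrite /l1 !big_ord1 !mxE ler_wpM2r// ler_norm.
Qed.

Lemma zhat_l1_lipschitz (a a' : 'M[R]_(N, d)) x : Xs x ->
  l1 (zhat phi a x - zhat phi a' x) <= Phi * l1 (a - a').
Proof.
move=> Xx; rewrite /l1 big_ord1 mulr_sumr; apply: ler_sum => i _.
by rewrite !mxE; exact: zhat1_lipschitz.
Qed.

Lemma Fbf_measurable i l (a : 'M[R]_(N, d)) : clballN Rr a ->
  measurable_fun D (fun u => Fbf J phi a u.1 u.2 i l).
Proof.
move=> Ba; under eq_fun do rewrite mxE.
apply: measurable_funM; first exact: dJ_zhat_measurable.
exact: phi_measurable.
Qed.

Lemma Fbf_lipschitz i l (a a' : 'M[R]_(N, d)) x y :
  clballN Rr a -> clballN Rr a' -> Xs x -> Ys y ->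
  `|Fbf J phi a x y i l - Fbf J phi a' x y i l| <= `|LF| * Phi ^+ 2 * l1 (a - a').
Proof.
move=> Ba Ba' Xx Yy; rewrite !mxE -mulrBl normrM.
have H := dJ_lipschitz i Yy (zhat_in_Zhat Ba Xx) (zhat_in_Zhat Ba' Xx).
apply: (@le_trans _ _ (`|LF| * (Phi * l1 (a - a')) * Phi)).
  apply: ler_pM => //; last exact: phiM.
  by apply: le_trans H _; rewrite ler_wpM2l// zhat_l1_lipschitz.
by rewrite le_eqVlt; apply/orP; left; apply/eqP; ring.
Qed.

Lemma hbf_lipschitz i (a a' : 'M[R]_(N, d)) x y :
  clballN Rr a -> clballN Rr a' -> Xs x -> Ys y ->
  `|hbf h phi i (row i a) x y - hbf h phi i (row i a') x y| <=
    `|Lh| * Phi * l1 (a - a').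
Proof.
move=> Ba Ba' Xx Yy.
apply: le_trans (A2h i Yy (zhat1_in_Zhat1 (Ba i) Xx) (zhat1_in_Zhat1 (Ba' i) Xx)) _.
apply: (@le_trans _ _ (`|Lh| * `|zhat1 phi (row i a) x - zhat1 phi (row i a') x|)).
  by rewrite ler_wpM2r// ler_norm.
rewrite -mulrA ler_wpM2l// (le_trans (zhat1_lipschitz _ _ _ Xx))// ler_wpM2l ?(ltW Phi0)//.
by rewrite /l1 (bigD1 i)//= lerDl; apply: sumr_ge0 => k _; exact: sumr_ge0.
Qed.

Variables (z0 : 'rV[R]_N) (M : R).
Hypotheses (Zz0 : Zhat phi Xs Rr z0).
Hypothesis z0M : forall y, Ys y ->
  norm2 (Fgame J z0 y) <= M /\ (forall i, `|h i (z0 0 i) y| <= M).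

Lemma Zhat_l1_bounded (z z' : 'rV[R]_N) : Zhat phi Xs Rr z -> Zhat phi Xs Rr z' ->
  l1 (z - z') <= (1 * N)%:R * (2 * BZ).
Proof.
move=> Zz Zz'; apply: l1_le => i j; rewrite !mxE (le_trans (ler_normB _ _))//.
by rewrite mulr_natl mulr2n lerD// Zhat_entry_bounded.
Qed.

(** The bound known at the single profile [z0] spreads to all of [Zhat] by the Lipschitz condition,
    since [Zhat] is bounded. *)
Lemma Fbf_bounded i l (a : 'M[R]_(N, d)) x y : clballN Rr a -> Xs x -> Ys y ->
  `|Fbf J phi a x y i l| <= (`|M| + `|LF| * ((1 * N)%:R * (2 * BZ))) * Phi.
Proof.
move=> Ba Xx Yy; rewrite mxE normrM; apply: ler_pM => //; last exact: phiM.
have Zz := zhat_in_Zhat Ba Xx.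
rewrite -[dJ _ _ _ _](subrK (dJ J i z0 y)) addrC (le_trans (ler_normD _ _))// lerD//.
  have := entry_le_norm2 (Fgame J z0 y) 0 i; rewrite mxE => /le_trans; apply.
  by have [/le_trans + _] := z0M Yy; apply; exact: ler_norm.
apply: le_trans (dJ_lipschitz i Yy Zz Zz0) _.
by rewrite ler_wpM2l// Zhat_l1_bounded.
Qed.

Lemma hbf_bounded i (b : 'rV[R]_d) x y : clball Rr b -> Xs x -> Ys y ->
  `|hbf h phi i b x y| <= `|M| + `|Lh| * (2 * BZ).
Proof.
move=> Bb Xx Yy; rewrite /hbf.
have Zt := zhat1_in_Zhat1 Bb Xx.
rewrite -[h _ _ _](subrK (h i (z0 0 i) y)) addrC (le_trans (ler_normD _ _))// lerD//.
  have [_ /(_ i)/le_trans] := z0M Yy; apply; exact: ler_norm.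
apply: le_trans (A2h i Yy Zt (Zz0 i)) _.
rewrite (le_trans (ler_norm _))// normrM normr_id ler_wpM2l//.
rewrite (le_trans (ler_normB _ _))// mulr_natl mulr2n lerD//.
  by rewrite (le_trans (Zhat1_bounded Zt))// /BZ lerDl.
by rewrite (le_trans (Zhat1_bounded (Zz0 i)))// /BZ lerDl.
Qed.

End game.

Theorem theorem1
  (R : realType) (dT : measure_display) (T : measurableType dT)
  (P : probability T R)
  (nx ny N d : nat) (HN : (0 < N)%N) (Hd : (0 < d)%N)
  (Rr lam : R) (HR : 0 < Rr) (Hlam : 0 < lam)
  (Xs : set 'rV[R]_nx) (Ys : set 'rV[R]_ny)
  (HXs : compact Xs) (HYs : compact Ys)
  (* the random variables X : Omega -> Xs, Y : Omega -> Ys *)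
  (X : T -> 'rV[R]_nx) (Y : T -> 'rV[R]_ny)
  (HX : forall w, Xs (X w)) (HY : forall w, Ys (Y w))
  (HXYm : forall B, borel B -> measurable ((fun w => (X w, Y w)) @^-1` B))
  (* basis functions *)
  (phi : 'I_d -> 'rV[R]_nx -> R)
  (Hphi : forall l, {within Xs, continuous (phi l)})
  (* objectives J^i(z^i; y, z^{-i}) = J i z y and constraints h^i(z^i; y) = h i z^i y *)
  (J : 'I_N -> 'rV[R]_N -> 'rV[R]_ny -> R)
  (h : 'I_N -> R -> 'rV[R]_ny -> R)
  (HJm : forall i z B, borel B -> borel (J i z @^-1` B))
  (Hhm : forall i t B, borel B -> borel (h i t @^-1` B))
  (* (A1) *)
  (A1 : forall i (z : 'rV[R]_N) y, Zhat phi Xs Rr z -> Ys y ->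
          (forall t, derivable (fun t => J i (setc z i t) y) t 1) /\
          continuous (derive1 (fun t => J i (setc z i t) y)))
  (* (A2) *)
  (LF Lh : R)
  (A2F : forall y, Ys y -> forall z z' : 'rV[R]_N,
          Zhat phi Xs Rr z -> Zhat phi Xs Rr z' ->
          norm2 (Fgame J z y - Fgame J z' y) <= LF * norm2 (z - z'))
  (A2h : forall i y, Ys y -> forall t t',
          Zhat1 phi Xs Rr t -> Zhat1 phi Xs Rr t' ->
          `|h i t y - h i t' y| <= Lh * `|t - t'|)
  (A2b : exists2 z : 'rV[R]_N, Zhat phi Xs Rr z &
          exists M : R, forall y, Ys y ->
            norm2 (Fgame J z y) <= M /\ (forall i, `|h i (z 0 i) y| <= M))
  (* (A4) *)
  (epsh : R) (Hepsh : 0 < epsh)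
  (A4 : forall i, exists b : 'rV[R]_d,
          clball Rr b /\ hbar P h phi X Y i b <= - epsh)
  (* the constant eps_diamond *)
  (epsd : R) (Hepsd : 0 < epsd < epsh)
  (Hrate : forall a : 'M[R]_(N, d), clballN Rr a ->
     (forall i l, rate_bound P
        (fun w => Fbf J phi a (X w) (Y w) i l - F0 P J phi X Y a i l) epsd) /\
     (forall i, rate_bound P
        (fun w => hbf h phi i (row i a) (X w) (Y w) - hbar P h phi X Y i (row i a))
        epsd))
  (* i.i.d. copies (Xk k, Yk k), k = 0, 1, 2, ... of (X, Y) *)
  (Xk : nat -> T -> 'rV[R]_nx) (Yk : nat -> T -> 'rV[R]_ny)
  (HXk : forall k w, Xs (Xk k w)) (HYk : forall k w, Ys (Yk k w))
  (HXYkm : forall k B, borel B -> measurable ((fun w => (Xk k w, Yk k w)) @^-1` B))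
  (Hind : indep_seq P (fun k w => (Xk k w, Yk k w)))
  (Hdist : forall k B, borel B ->
     P ((fun w => (Xk k w, Yk k w)) @^-1` B) = P ((fun w => (X w, Y w)) @^-1` B))
  (alpha : R) (Halpha : 0 < alpha < 1 / 2) :
  let E := Event P J h phi X Y Xk Yk Rr lam epsd alpha in
  P.-negligible [set w | forall n0 : nat, exists n, (n0 <= n)%N /\ (0 < n)%N /\ ~ E n w]
  /\ exists2 Om : set T, measurable Om /\ P Om = 1%E &
       forall w, Om w -> exists2 nw : nat, (0 < nw)%N &
         forall n, (nw < n)%N -> E n w.
Proof.
move=> E.
have /andP[epsd0 _] := Hepsd.
pose V := ('rV[R]_nx * 'rV[R]_ny)%type; pose U := borelType V.
pose D : set U := Xs `*` Ys.
pose Z k : T -> U := fun w => (Xk k w, Yk k w).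
pose Z0 : T -> U := fun w => (X w, Y w).
have mZ k : measurable_fun setT (Z k).
  by move=> _ B mB; rewrite setTI; exact: HXYkm.
have mZ0 : measurable_fun setT Z0.
  by move=> _ B mB; rewrite setTI; exact: HXYm.
have Zlaw k B : measurable B -> P (Z k @^-1` B) = P (Z0 @^-1` B) by exact: Hdist.
have Zind := @integral_prod_indic_indep R dT T P V Z mZ Hind.
have mD : measurable D by exact: domain_measurable.
have DZ k w : D (Z k w) by split; [exact: HXk|exact: HYk].
have DZ0 w : D (Z0 w) by split; [exact: HX|exact: HY].
have [Phi Phi0 phiM] := compact_family_bounded HXs Hphi.
have [z0 Zz0 [M z0M]] := A2b.
have A1d i z y (Zz : Zhat phi Xs Rr z) (Yy : Ys y) := (A1 i z y Zz Yy).1.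
(* Constraints are also viewed as functions of the whole profile, so that one index type and one set
   [clballN Rr] serve both families. *)
pose psi (j : 'I_N * 'I_d + 'I_N) (a : 'M[R]_(N, d)) (u : U) : R :=
  match j with
  | inl p => Fbf J phi a u.1 u.2 p.1 p.2
  | inr i => hbf h phi i (row i a) u.1 u.2
  end.
pose dev j n a w := `|n%:R^-1 * \sum_(k < n) psi j a (Z k w) - Ex P (psi j a \o Z0)|.
(* [N * d] entries, each off by at most c n^(-alpha), add up to strictly less than epsilon_n thanks
   to the successor; also [c <= epsd], as the constraints require. *)
pose c := epsd / (N * d).+1%:R.
have c0 : 0 < c by rewrite divr_gt0.
pose bad j := [set w | forall n0 : nat, exists n, (n0 <= n)%N /\ (0 < n)%N /\
  exists2 a, clballN Rr a & c * n%:R `^ (- alpha) <= dev j n a w].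
have bad_negligible j : P.-negligible (bad j).
  pose MF := (`|M| + `|LF| * ((1 * N)%:R * (2 * (d%:R * (Rr * Phi) + 1)))) * Phi.
  pose Mh := `|M| + `|Lh| * (2 * (d%:R * (Rr * Phi) + 1)).
  have ball_entry := @clballN_entry R N d Rr.
  case: j => [[i l]|i].
  - apply: (uniform_rate_on (M := `|MF| + 1) (L := `|LF| * Phi ^+ 2)
      mZ mZ0 Zlaw Zind mD DZ DZ0 HR ball_entry _ _ _ _ _ c0 Halpha).
    + move=> a Ba; exact: (Fbf_measurable HR HXs Hphi Phi0 phiM HJm A1d A2F).
    + exact: ltr_wpDl.
    + move=> a Ba u [Xu Yu]; rewrite (le_trans (Fbf_bounded phiM A2F Zz0 z0M i l Ba Xu Yu))//.
      by rewrite (le_trans (ler_norm _))// lerDl.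
    + by rewrite mulr_ge0// sqr_ge0.
    + by move=> a a' Ba Ba' u [Xu Yu]; exact: (Fbf_lipschitz phiM A2F).
  - apply: (uniform_rate_on (M := `|Mh| + 1)
      (L := `|Lh| * Phi) mZ mZ0 Zlaw Zind mD DZ DZ0 HR ball_entry _ _ _ _ _ c0 Halpha).
    + by move=> a Ba; exact: (hbf_measurable HR HXs Hphi Phi0 phiM Hhm A2h).
    + exact: ltr_wpDl.
    + move=> a Ba u [Xu Yu]; rewrite (le_trans (hbf_bounded phiM A2h Zz0 z0M i (Ba i) Xu Yu))//.
      by rewrite (le_trans (ler_norm _))// lerDl.
    + by rewrite mulr_ge0// ltW.
    + by move=> a a' Ba Ba' u [Xu Yu]; exact: (hbf_lipschitz Phi0 phiM A2h).
have E_of_dev n w : (0 < n)%N ->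
    (forall j a, clballN Rr a -> dev j n a w < c * n%:R `^ (- alpha)) -> E n w.
  move=> n0 dev_lt.
  have pow0 : 0 < n%:R `^ (- alpha) :> R by rewrite powR_gt0// ltr0n.
  have c_le : c * n%:R `^ (- alpha) <= epsn epsd alpha n.
    rewrite ler_pM2r// ler_pdivrMr// ler_peMr ?(ltW epsd0)// ler1n//.
  have hdev a i : clballN Rr a ->
      `|hemp h phi Xk Yk i n w (row i a) - hbar P h phi X Y i (row i a)| < epsn epsd alpha n.
    by move=> Ba; exact: lt_le_trans (dev_lt (inr i) a Ba) c_le.
  split; [|split].
  - move=> a Ba; apply: le_lt_trans (norm2_le_l1 _) _.
    apply: (@le_lt_trans _ _ ((N * d)%:R * (c * n%:R `^ (- alpha)))).
      apply: l1_le => i l.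
      (* The regularization [lam *: a] cancels in the difference. *)
      have := ltW (dev_lt (inl (i, l)) a Ba); rewrite /dev /=.
      congr (_ <= _); congr `|_|.
      by rewrite !mxE summxE; ring.
    rewrite mulrA ltr_pM2r// /c mulrCA gtr_pMr// ltr_pdivrMr// mul1r ltr_nat.
    exact: ltnSn.
  - move=> a Aa i; have [Ba ha] := Aa i; split=> //.
    have := hdev a i (fun k => (Aa k).1); rewrite ltr_norml => /andP[_ ?].
    lra.
  - move=> a Aa i; have [Ba ha] := Aa i; split=> //.
    have := hdev a i (fun k => (Aa k).1); rewrite ltr_norml => /andP[? _].
    lra.
have bad_sub : [set w | forall n0 : nat, exists n, (n0 <= n)%N /\ (0 < n)%N /\ ~ E n w] `<=`
    \bigcup_(j in [set: 'I_N * 'I_d + 'I_N]) bad j.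
  move=> w limsup; apply: contrapT => nbad.
  have /choice[n0 n0P] : forall j, exists n0, forall n, (n0 <= n)%N -> (0 < n)%N ->
      forall a, clballN Rr a -> dev j n a w < c * n%:R `^ (- alpha).
    move=> j; apply: contrapT => nex; apply: nbad; exists j => // n0.
    apply: contrapT => nn; apply: nex; exists n0 => n n0n n1 a Ba.
    rewrite ltNge; apply/negP => le_dev; apply: nn.
    by exists n; split => //; split => //; exists a.
  (* The index type is finite, so the largest threshold works for every family at once. *)
  have [n [mn [n1 nE]]] := limsup (\max_j n0 j)%N.
  apply: nE; apply: E_of_dev => // j a Ba; apply: n0P => //.
  by apply: leq_trans mn; exact: leq_bigmax.
have limsup_negligible : P.-negligible
    [set w | forall n0 : nat, exists n, (n0 <= n)%N /\ (0 < n)%N /\ ~ E n w].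
  exact: negligibleS bad_sub (negligible_fin_bigcup bad_negligible).
split=> //.
have [B [mB PB limsupB]] := limsup_negligible.
(* The limsup itself may fail to be measurable; the complement of a measurable null set covering it
   is the required event. *)
exists (~` B); first by split; [exact: measurableC|rewrite probability_setC// PB sube0].
move=> w nBw; apply: contrapT => nex; apply: nBw; apply: limsupB => n0.
apply: contrapT => nn; apply: nex; exists n0.+1 => // n n0n.
apply: contrapT => nE; apply: nn; exists n; split; first exact: ltnW (ltnW n0n).
by split=> //; exact: leq_ltn_trans n0n.
Qed.
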